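(* For each $c\in P$, $$\inf_{\mu_\delta\in\mathcal{P}_\delta}\int_{\mathbb{T}^d\times\mathbb{T}\times\mathbb{R}^d}L^{(c)}(x,t-\tau,\zeta)\,d\mu_\delta=-\bar H_\delta(c),$$ and there exists at least one minimizing probability measure $\mu^*_\delta\in\mathcal{P}_\delta$ that attains the infimum.
   Context: Lagrangian: $\mathbb{T}=\mathbb{R}/\mathbb{Z}$, $\mathbb{T}^d=\mathbb{R}^d/\mathbb{Z}^d$; functions on tori are identified with $1$-periodic functions. $|x|_\infty=\max_j|x^j|$, $|\cdot|$ is the Euclidean norm. $L=L(x,t,\zeta):\mathbb{T}^d\times\mathbb{T}\times\mathbb{R}^d\to\mathbb{R}$ is $C^2$; $L_{\zeta\zeta}$ is positive definite everywhere; for each $a\ge0$ there is $b_1(a)\in\mathbb{R}$ with $L\ge a|\zeta|+b_1(a)$ everywhere; there is $\alpha>0$ with $|L_{x^j}|\le\alpha(1+|L|)$ everywhere ($j=1,\dots,d$). $H(x,t,p)=\sup_{\zeta\in\mathbb{R}^d}(p\cdot\zeta-L(x,t,\zeta))$, $L^{(c)}(x,t,\zeta)=L(x,t,\zeta)-c\cdot\zeta$. $P\subset\mathbb{R}^d$ is a fixed compact convex set and $r>0$ is a fixed number. Grid: $\delta=(h,\tau)$, $h=(2N)^{-1}$, $\tau=(2K)^{-1}$ with $N,K\in\mathbb{N}$, $\lambda=\tau/h$; $x_m=hm$ ($m\in\mathbb{Z}^d$), $t_k=\tau k$ ($k\in\mathbb{Z}$). $G_{\rm even}$ (resp. $G_{\rm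 odd}$) is the set of $x_m$ with $m^1+\dots+m^d$ even (resp. odd). $\mathcal{G}_\delta=\bigcup_{k}\{(G_{\rm even}\times\{t_{2k}\})\cup(G_{\rm odd}\times\{t_{2k+1}\})\}$, $\tilde{\mathcal{G}}_\delta=\bigcup_{k}\{(G_{\rm odd}\times\{t_{2k}\})\cup(G_{\rm even}\times\{t_{2k+1}\})\}$; ${\rm pr.}\,\tilde{\mathcal{G}}_\delta$ is the set of $(x_m,t_k)\in\tilde{\mathcal{G}}_\delta$ with $0\le m^i\le2N-1$, $0\le k\le2K-1$. $e_1,\dots,e_d$ is the standard basis, $B=\{\pm e_1,\dots,\pm e_d\}$. For a grid point $x$, $m(x)$ is its index. For $v:\tilde{\mathcal{G}}_\delta\to\mathbb{R}$ write $v^k_m=v(x_m,t_k)$ and, for $(x_m,t_k)\in\mathcal{G}_\delta$, $(D_{x^j}v)^k_m=\frac{v^k_{m+e_j}-v^k_{m-e_j}}{2h}$, $D_xv=(D_{x^1}v,\dots,D_{x^d}v)$, $(D_tv)^{k+1}_m=\frac1\tau\big(v^{k+1}_m-\frac1{2d}\sum_{\omega\in B}v^k_{m+\omega}\big)$. Solution map: $X_\delta$ is the set of $w:G_{\rm odd}\to\mathbb{R}$, $1$-periodic in each coordinate, with $|D_xw|_\infty\le r$ on $G_{\rm even}$. For $v^0\in X_\delta$, $c\in P$, $\varphi^k_\delta(v^0;c)=v(\cdot,t_k)$, where $(D_tv)^{k+1}_m+H(x_m,t_k,c+(D_xv)^k_m)=0$, $v(\cdot,0)=v^0$; $\varphi_\delta=\varphi^{2K}_\delta$.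 $\bar H_\delta(c)$ is the unique real number for which some $\bar v^0\in X_\delta$ satisfies $\varphi_\delta(\bar v^0;c)+\bar H_\delta(c)=\bar v^0$. Standing assumption: $r$ is large enough and $\delta$ small enough, with $\lambda<\lambda_1$ for a constant $\lambda_1=\lambda_1(r,P)>0$, so that for every $c\in P$ and $v^0\in X_\delta$, $\varphi_\delta(\cdot;c)$ maps $X_\delta$ into itself and $|H_p(x_m,t_k,c+(D_xv)^k_m)|_\infty\le(d\lambda_1)^{-1}<(d\lambda)^{-1}$ for all $k\ge0$, $m$, where $v$ is the solution with initial datum $v^0$. Measures: an admissible control is a function $\xi:{\rm pr.}\,\tilde{\mathcal{G}}_\delta\to[-(d\lambda)^{-1},(d\lambda)^{-1}]^d$, identified with its $1$-periodic extension (in space and time) to $\tilde{\mathcal{G}}_\delta$; $\xi^k_m=\xi(x_m,t_k)$. Fix a starting point $x_{n_0}\in G_{\rm odd}$. For $l\in\mathbb{N}$ consider the backward random walk $(\gamma^k)_{-l\le k\le0}$ with $\gamma^0=x_{n_0}$ jumping from $(x_m,t_{k+1})$ to $(x_m+h\omega,t_k)$ with probability $\frac1{2d}-\frac\lambda2\omega\cdot\xi^{k+1}_m$, $\omega\in B$, with expectation $E$. Let $\mu^l_\delta(\xi)$ be the probability measure on $\mathbb{T}^d\times\mathbb{T}\times\mathbb{R}^d$ with $$\int f\,d\mu^l_\delta(\xi)=E\Big[\frac1{t_l}\sum_{-l<k\le0}f(\gamma^k,t_k,\xi^k_{m(\gamma^k)})\tau\Big]\quad\text{for all }f\in C_c(\mathbb{T}^d\times\mathbb{T}\times\mathbb{R}^d;\mathbb{R}).$$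 $\mathcal{P}_\delta$ is the family of all probability measures that are weak limits of subsequences of $\{\mu^l_\delta(\xi)\}_{l\in\mathbb{N}}$ as $l\to\infty$, for all admissible controls $\xi$. *)

(* Defs.v *)
From HB Require Import structures.
From mathcomp Require Import all_boot all_order all_algebra.
From mathcomp Require Import ring_quotient.
From mathcomp Require Import all_classical all_reals all_analysis.

Set Implicit Arguments.
Unset Strict Implicit.
Unset Printing Implicit Defensive.

Import Order.TTheory GRing.Theory Num.Theory.
Import numFieldNormedType.Exports.

Local Open Scope classical_set_scope.
Local Open Scope ring_scope.

(* On ['rV[R]_d] the library norm [`|x|] is the maximum norm; [enorm] is the
   Euclidean one. *)
Definition dot (R : realType) d (u v : 'rV[R]_d) : R := \sum_j u 0 j * v 0 j.

Definition enorm (R : realType) d (u : 'rV[R]_d) : R := Num.sqrt (dot u u).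

Section Lagrangian.
Variables (R : realType) (d : nat).
Implicit Types (x zeta p c : 'rV[R]_d) (t : R).

Implicit Type L : 'rV[R]_d * R * 'rV[R]_d -> R.

Definition C2 (f : 'rV[R]_d * R * 'rV[R]_d -> R) : Prop :=
  [/\ continuous f,
      forall u, (forall z, derivable f z u) /\ continuous ('D_u f) &
      forall u v, (forall z, derivable ('D_u f) z v) /\
                  continuous ('D_v ('D_u f))].

Definition dir_x (j : 'I_d) : 'rV[R]_d * R * 'rV[R]_d := (delta_mx 0 j, 0, 0).
Definition dir_zeta (j : 'I_d) : 'rV[R]_d * R * 'rV[R]_d :=
  (0, 0, delta_mx 0 j).

Definition hess_zeta L z : 'M[R]_d :=
  \matrix_(i, j) 'D_(dir_zeta i) ('D_(dir_zeta j) L) z.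

Definition posdef (A : 'M[R]_d) : Prop :=
  forall v : 'rV[R]_d, v != 0 -> 0 < (v *m A *m v^T) 0 0.

Definition periodic_phase L : Prop :=
  (forall j x t zeta, L (x + delta_mx 0 j, t, zeta) = L (x, t, zeta)) /\
  (forall x t zeta, L (x, t + 1, zeta) = L (x, t, zeta)).

Definition lagrangian L : Prop :=
  [/\ periodic_phase L,
      C2 L,
      forall z, posdef (hess_zeta L z),
      forall a : R, 0 <= a ->
        exists b : R, forall z, a * enorm z.2 + b <= L z &
      exists2 alpha : R, 0 < alpha &
        forall j z, `|'D_(dir_x j) L z| <= alpha * (1 + `|L z|)].

Definition hamiltonian L x t p : R :=
  sup [set dot p zeta - L (x, t, zeta) | zeta in setT].

Definition hamiltonian_p L x t p : 'rV[R]_d :=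
  \row_j 'D_(delta_mx 0 j) (hamiltonian L x t) p.

Definition lagrangian_c L c x t zeta : R := L (x, t, zeta) - dot c zeta.

End Lagrangian.

Section Grid.
Variables (R : realType) (d N K : nat).
Implicit Types (m : 'rV[int]_d) (k : int).

(* A grid point (x_m, t_k) is given by its indices.  A grid function is a total
   function of the indices; its values off the grid on which it is meant to
   live are never used. *)
Definition hstep : R := (2 * N)%:R^-1.
Definition tstep : R := (2 * K)%:R^-1.
Definition mesh_ratio : R := tstep / hstep.

Definition xpt m : 'rV[R]_d := hstep *: map_mx intr m.
Definition tpt k : R := tstep * k%:~R.

Definition on_G m k : bool := (2 %| (\sum_j m 0 j + k)%R)%Z.
Definition on_Gt m k : bool := ~~ on_G m k.
Definition even_pt m : bool := (2 %| (\sum_j m 0 j)%R)%Z.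
Definition odd_pt m : bool := ~~ even_pt m.

(* [(j, false)] stands for e_j and [(j, true)] for - e_j. *)
Definition jump : finType := ('I_d * bool)%type.
Definition omega (w : jump) : 'rV[int]_d := (-1) ^+ w.2 *: delta_mx 0 w.1.

Definition space_period (j : 'I_d) : 'rV[int]_d := delta_mx 0 j *+ (2 * N).

Definition Dx (w : 'rV[int]_d -> R) m : 'rV[R]_d :=
  \row_j ((w (m + delta_mx 0 j) - w (m - delta_mx 0 j)) / (2 * hstep)).

Definition neighbour_mean (w : 'rV[int]_d -> R) m : R :=
  (2 * d)%:R^-1 * \sum_(b : jump) w (m + omega b).

Definition Dt (v : nat -> 'rV[int]_d -> R) (k : nat) m : R :=
  (v k.+1 m - neighbour_mean (v k) m) / tstep.

Definition Xdelta (r : R) (w : 'rV[int]_d -> R) : Prop :=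
  (forall m j, odd_pt m -> w (m + space_period j) = w m) /\
  (forall m, even_pt m -> `|Dx w m| <= r).

Variable L : 'rV[R]_d * R * 'rV[R]_d -> R.

(* The scheme is explicit in time: [phi] is its equation (lemma [phi_scheme])
   solved for the new value. *)
Fixpoint phi (c : 'rV[R]_d) (v0 : 'rV[int]_d -> R) (k : nat) :
    'rV[int]_d -> R :=
  if k is k'.+1 then fun m =>
    neighbour_mean (phi c v0 k') m
    - tstep * hamiltonian L (xpt m) (tpt k') (c + Dx (phi c v0 k') m)
  else v0.

Lemma phi_scheme c v0 (k : nat) m : (0 < K)%N ->
  Dt (phi c v0) k m + hamiltonian L (xpt m) (tpt k) (c + Dx (phi c v0 k) m) = 0.
Proof.
move=> K0; rewrite /Dt /= addrAC subrr add0r mulNr mulrAC divff ?mul1r ?addNr//.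
by rewrite /tstep invr_eq0 pnatr_eq0 muln_eq0 -lt0n.
Qed.

Definition is_effective_hamiltonian (r : R) (c : 'rV[R]_d) (Hc : R) : Prop :=
  exists2 vbar, Xdelta r vbar &
    forall m, odd_pt m -> phi c vbar (2 * K) m + Hc = vbar m.

(* The number characterised by [is_effective_hamiltonian]; 0 is only the default
   of the description operator. *)
Definition Hbar (r : R) (c : 'rV[R]_d) : R :=
  xget 0 (is_effective_hamiltonian r c).

End Grid.

Section Torus.
Local Open Scope quotient_scope.
Variables (R : realType) (d : nat).

(* T^d = R^d / Z^d and T = R / Z with their quotient topologies; the subgroup
   divided out consists of the vectors (numbers) with integer entries, see
   [to_torusP] and [to_circleP]. *)
Definition torus : Type := quotient_topology
  {ideal_quot GRing.ZmodClosed.clone _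
     (@mxOver_pred 1 d _ (@Num.int_num_subdef R)) _}.
Definition circle : Type := quotient_topology
  {ideal_quot GRing.ZmodClosed.clone _ (@Num.int_num_subdef R) _}.

HB.instance Definition _ := PointedTopological.on torus.
HB.instance Definition _ := Quotient.on torus.
HB.instance Definition _ := PointedTopological.on circle.
HB.instance Definition _ := Quotient.on circle.

Definition to_torus (x : 'rV[R]_d) : torus := \pi_torus x.
Definition to_circle (t : R) : circle := \pi_circle t.

Lemma to_torusP (x y : 'rV[R]_d) :
  to_torus x = to_torus y <-> x - y \is a mxOver Num.int.
Proof.
rewrite -[_ \is a _]/(x - y \in GRing.ZmodClosed.clone _
  (@mxOver_pred 1 d _ (@Num.int_num_subdef R)) _) Quotient.idealrBE.
by split=> [|/eqP] // h; exact/eqP.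
Qed.

Lemma to_circleP (s t : R) :
  to_circle s = to_circle t <-> s - t \is a Num.int.
Proof.
rewrite -[_ \is a _]/(s - t \in GRing.ZmodClosed.clone _
  (@Num.int_num_subdef R) _) Quotient.idealrBE.
by split=> [|/eqP] // h; exact/eqP.
Qed.

Definition state : Type := (torus * circle * 'rV[R]_d)%type.
HB.instance Definition _ :=
  Topological.copy state (torus * circle * 'rV[R]_d)%type.
HB.instance Definition _ := Pointed.copy state (torus * circle * 'rV[R]_d)%type.

Definition borel_state := g_sigma_algebraType (@open state).

End Torus.

Section Measures.
Variables (R : realType) (d N K : nat).
Implicit Types (m n : 'rV[int]_d) (xi : int -> 'rV[int]_d -> 'rV[R]_d).

Local Notation hstep := (hstep R N).
Local Notation tstep := (tstep R K).
Local Notation mesh_ratio := (mesh_ratio R N K).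

(* [xi k m] is the value at (x_m, t_k); a control on pr.G~ is given by its
   periodic extension to G~. *)
Definition admissible xi : Prop := forall k m, on_Gt m k ->
  [/\ `|xi k m| <= (d%:R * mesh_ratio)^-1,
      xi (k + (2 * K)%:Z) m = xi k m &
      forall j, xi k (m + space_period N j) = xi k m].

Definition jump_proba (zeta : 'rV[R]_d) (b : jump d) : R :=
  (2 * d)%:R^-1 - mesh_ratio / 2 * dot (map_mx intr (omega b)) zeta.

(* A path of the walk on [-l, 0] is the sequence of its [l] jumps, in the order
   in which they are made, that is backward in time: [position n p i] is the
   index of gamma^(-i). *)
Definition position n (p : seq (jump d)) (i : nat) : 'rV[int]_d :=
  n + \sum_(b <- take i p) omega b.

Definition path_proba xi n l (p : l.-tuple (jump d)) : R :=
  \prod_(i < l) jump_proba (xi (- i%:Z) (position n p i)) (tnth p i).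

Definition walk_expectation xi n l (F : l.-tuple (jump d) -> R) : R :=
  \sum_(p : l.-tuple (jump d)) path_proba xi n p * F p.

(* The summation index -l < k <= 0 is written k = - i with 0 <= i < l. *)
Definition time_average xi n l (f : state R d -> R) (p : l.-tuple (jump d)) :
    R :=
  (tpt R K l%:Z)^-1 *
  \sum_(i < l)
    f (to_torus (xpt R N (position n p i)), to_circle (tpt R K (- i%:Z)),
       xi (- i%:Z) (position n p i)) * tstep.

Definition compactly_supported (f : state R d -> R) : Prop :=
  compact (closure [set z | f z != 0]).

Definition is_walk_measure xi n (l : nat)
    (mu : probability (borel_state R d) R) : Prop :=
  forall f : state R d -> R, continuous f -> compactly_supported f ->
    (\int[mu]_z (f z)%:E)%E =
    (walk_expectation xi n (time_average xi n (l := l) f))%:E.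

Definition weak_cvg (mu_ : nat -> probability (borel_state R d) R)
    (mu : probability (borel_state R d) R) : Prop :=
  forall f : state R d -> R, continuous f ->
    (exists M : R, forall z, `|f z| <= M) ->
    (\int[mu_ i]_z (f z)%:E)%E @[i --> \oo] --> (\int[mu]_z (f z)%:E)%E.

Definition Pdelta n : set (probability (borel_state R d) R) :=
  [set mu | exists xi, admissible xi /\
     exists mu_ : nat -> probability (borel_state R d) R,
       (forall l, (0 < l)%N -> is_walk_measure xi n l (mu_ l)) /\
       exists2 s : nat -> nat, {homo s : i j / (i < j)%N} &
         weak_cvg (fun i => mu_ (s i)) mu].

(* The integrand is 1-periodic in its first two variables, so the choice of
   representatives does not matter. *)
Definition action (L : 'rV[R]_d * R * 'rV[R]_d -> R) (c : 'rV[R]_d)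
    (mu : probability (borel_state R d) R) : \bar R :=
  (\int[mu]_z
     (lagrangian_c L c (repr z.1.1) (repr z.1.2 - tstep) z.2)%:E)%E.

End Measures.

(* Main.v *)
Require Import Defs.
From HB Require Import structures.
From mathcomp Require Import all_boot all_order all_algebra.
From mathcomp Require Import all_classical all_reals all_analysis.
From mathcomp Require Import measurable_realfun.
From mathcomp Require Import ring lra zify.

Set Implicit Arguments.
Unset Strict Implicit.
Unset Printing Implicit Defensive.

Import Order.TTheory GRing.Theory Num.Theory.
Import numFieldNormedType.Exports.

Local Open Scope classical_set_scope.
Local Open Scope ring_scope.

(** The theorem rests on dynamic programming. The scheme is monotone: writing the
    Hamiltonian as a Legendre transform, one step of it at a grid point reads
      v^{k+1}_m = min over zeta of
        tau L^(c)(x_m, t_k, zeta) + sum_b p_b(zeta) v^k_{m + omega b},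
    where p_b(zeta) are the jump probabilities of the walk with velocity zeta, and
    the minimum is attained at zeta = H_p(x_m, t_k, c + D_x v)
    ([scheme_step_le], [scheme_step_eq]). This uses that H is differentiable with
    gradient the maximising velocity ([legendre_max_hamiltonian_p]), which holds
    because L is strictly convex and superlinear in the velocity.

    The bound on H_p makes all optimal jump probabilities at least some rho > 0.
    Two solutions therefore get closer up to constants: after enough steps every
    grid point is linked to a fixed one with probability bounded below, and the
    oscillation of the difference of two solutions shrinks by a fixed factor
    ([osc_contract]). Normalised iterates then converge to a function vbar that one
    time period changes by a constant, which is the existence of Hbar
    ([effective_hamiltonian_exists]).

    Extend the solution starting from vbar to all times. Iterating the one-step
    inequality along the walk with any admissible control xi, l steps back from time
    0, shows that the expected time average of L^(c) is at least - Hbar - M / t_l: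
    the boundary terms grow like t_l Hbar up to a bounded error
    ([mean_action_ge]). For the control that is optimal for vbar the inequality is an
    equality, hence the average is at most - Hbar + M / t_l
    ([mean_action_optimal_le]).

    It remains to pass to weak limits. Velocities of admissible controls lie in a
    fixed ball, so limits do not lose mass and the action of a limit measure is the
    limit of these time averages ([mean_action_cvg]). A limit exists for the optimal
    control because a walk with a periodic control visits only finitely many points
    of the state space, where its measures are given by points of a compact simplex
    ([limit_measure_exists]). *)

(** * Directional derivatives *)

Section DirectionalDerivatives.
Variables (R : realType) (V : normedModType R).
Implicit Types (f : V -> R) (u v y : V).

Lemma is_derive_line f y v (s : R) : derivable f (s *: v + y) v ->
  is_derive s 1 (fun s => f (s *: v + y)) ('D_v f (s *: v + y)).
Proof.
have E : (fun h : R => h^-1 *: (((fun s => f (s *: v + y)) \o shift s) (h *: 1)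
            - f (s *: v + y))) =
    (fun h : R => h^-1 *: ((f \o shift (s *: v + y)) (h *: v)
            - f (s *: v + y))).
  by apply/funext => h /=; rewrite scalerDl addrA [h *: 1]mulr1.
by move=> df; apply: DeriveDef; rewrite /derivable /derive E.
Qed.

Lemma mean_value_line f y v (s : R) : (forall z, derivable f z v) ->
  exists2 th : R, `|th| <= `|s| &
    f (s *: v + y) - f y = s * 'D_v f (th *: v + y).
Proof.
move=> df.
have dg (x : R) : is_derive x 1 (fun s => f (s *: v + y)) ('D_v f (x *: v + y)).
  exact: is_derive_line.
have cg (i : interval R) : {within [set` i], continuous (fun s => f (s *: v + y))}.
  by apply: derivable_within_continuous => x _; have [] := dg x.
have [s0|s0] := leP 0 s.
  have [t] := MVT_segment s0 (fun x _ => dg x) (cg _).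
  rewrite in_itv/= => /andP[t0 ts] E; exists t; first by rewrite !ger0_norm.
  by move: E; rewrite scale0r add0r subr0 mulrC.
have [t] := MVT_segment (ltW s0) (fun x _ => dg x) (cg _).
rewrite in_itv/= => /andP[t0 ts] E; exists t.
  by rewrite !ler0_norm ?lerN2// ltW.
by move: E; rewrite scale0r !add0r => E; rewrite -opprB E mulrN opprK mulrC.
Qed.

(** The difference quotient along [u + v] splits into one along [v] at the base
    point and one along [u] at a nearby point; the mean value theorem turns the
    latter into a value of ['D_u f], which is continuous. *)
Lemma deriveD_dir f u v z : (forall y, derivable f y u) -> continuous ('D_u f) ->
  derivable f z v -> derivable f z (u + v) -> 'D_(u + v) f z = 'D_u f z + 'D_v f z.
Proof.
move=> du cu dv duv.
have H : (fun h : R => h^-1 *: ((f \o shift z) (h *: (u + v)) - f z)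
   - h^-1 *: ((f \o shift z) (h *: v) - f z)) @ 0^' --> 'D_(u + v) f z - 'D_v f z.
  by apply: cvgB; [exact: duv|exact: dv].
suff H2 : (fun h : R => h^-1 *: ((f \o shift z) (h *: (u + v)) - f z)
   - h^-1 *: ((f \o shift z) (h *: v) - f z)) @ 0^' --> 'D_u f z.
  apply/eqP; rewrite -subr_eq; apply/eqP.
  by rewrite -(cvg_lim _ H)// -(cvg_lim _ H2).
apply/cvgrPdist_le => e e0.
have /cvgrPdist_le /(_ _ e0) /nbhs_ballP[r /= r0 Hr] := cu z.
pose M := `|u| + `|v| + 1.
have M0 : 0 < M by rewrite ltr_wpDl.
near=> h.
have h0 : h != 0 by near: h; exact: nbhs_dnbhs_neq.
have [th thh E] := mean_value_line (h *: v + z) h du.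
have -> : h^-1 *: ((f \o shift z) (h *: (u + v)) - f z)
   - h^-1 *: ((f \o shift z) (h *: v) - f z) = 'D_u f (th *: u + (h *: v + z)).
  rewrite -scalerBr /= (_ : _ - _ - _ = h * 'D_u f (th *: u + (h *: v + z))).
    by rewrite [_ *: _]mulrA mulVf// mul1r.
  by rewrite -E scalerDr addrA; ring.
apply: Hr; rewrite -ball_normE /= opprD addrCA opprD.
rewrite (_ : _ + _ = - (th *: u + h *: v)); last first.
  by rewrite [- (h *: v) - z]addrC [z + _]addrA subrr add0r opprD.
rewrite normrN (le_lt_trans (ler_normD _ _))// !normrZ.
have hr : `|h| < r / M.
  near: h; apply: dnbhs0_lt.
  by rewrite divr_gt0.
apply: (@le_lt_trans _ _ (`|h| * M)); last by rewrite -ltr_pdivlMr.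
rewrite /M !mulrDr -addrA lerD//; first by rewrite ler_wpM2r.
by rewrite mulr1 lerDl.
Unshelve. all: by end_near. Qed.

Lemma deriveZ_dir f a u z : (forall y, derivable f y u) ->
  'D_(a *: u) f z = a * 'D_u f z.
Proof.
move=> du; have [->|a0] := eqVneq a 0; first by rewrite scale0r derive0 mul0r.
have d := is_derive_line (s := 0) (y := z) (du _).
rewrite scale0r add0r in d.
have dda : is_derive (0 : R) 1 (fun s : R => a * s) a.
  by apply: is_derive_eq; rewrite /= scaler1 ?addr0.
have d' : is_derive (a * 0) (1 : R) (fun s => f (s *: u + z)) ('D_u f z).
  by rewrite mulr0.
have [_ E] := is_derive1_comp d' dda.
have := E; rewrite mulrC => <-.
suff E' : (fun h : R => h^-1 *: ((f \o shift z) (h *: (a *: u)) - f z)) =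
    (fun h : R => h^-1 *: ((((fun s : R => f (s *: u + z)) \o *%R a) \o shift 0)
       (h *: 1) - f ((a * 0) *: u + z))) by rewrite /derive E'.
apply/funext => h /=.
by rewrite !addr0 mulr0 scale0r add0r scalerA [h *: 1]mulr1 (mulrC a).
Qed.

Lemma derive_sum_dir f (I : finType) (a : I -> R) (e : I -> V) z :
  (forall u, (forall y, derivable f y u) /\ continuous ('D_u f)) ->
  'D_(\sum_i a i *: e i) f z = \sum_i a i * 'D_(e i) f z.
Proof.
move=> df; elim/big_rec2 : _ => [|i x y _ IH]; first by rewrite derive0.
have [d1 _] := df (e i).
have [dai cai] := df (a i *: e i); have [dy _] := df y.
have [day _] := df (a i *: e i + y).
by rewrite (deriveD_dir dai cai (dy z) (day z)) IH (deriveZ_dir _ _ d1).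
Qed.

End DirectionalDerivatives.

(** * Scalar product and norms *)

Section DotAndNorms.
Variables (R : realType) (d : nat).
Implicit Types u v p : 'rV[R]_d.

Lemma coord_le_norm v j : `|v 0 j| <= `|v|.
Proof.
rewrite [leRHS]/Num.norm/= mx_normrE.
by apply/bigmax_geP; right; exists (0, j).
Qed.

Lemma dotDl u v p : dot (u + v) p = dot u p + dot v p.
Proof. by rewrite /dot -big_split; apply: eq_bigr => j _; rewrite mxE mulrDl. Qed.

Lemma dotDr u v p : dot p (u + v) = dot p u + dot p v.
Proof. by rewrite /dot -big_split; apply: eq_bigr => j _; rewrite mxE mulrDr. Qed.

Lemma dotNr u p : dot p (- u) = - dot p u.
Proof. by rewrite /dot -sumrN; apply: eq_bigr => j _; rewrite mxE mulrN. Qed.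

Lemma dotZl (a : R) u p : dot (a *: u) p = a * dot u p.
Proof. by rewrite /dot mulr_sumr; apply: eq_bigr => j _; rewrite mxE mulrA. Qed.

Lemma dotZr (a : R) u p : dot p (a *: u) = a * dot p u.
Proof. by rewrite /dot mulr_sumr; apply: eq_bigr => j _; rewrite mxE mulrCA. Qed.

Lemma dot0r p : dot p 0 = 0.
Proof. by rewrite /dot big1 // => j _; rewrite mxE mulr0. Qed.

Lemma dot_deltal j p : dot (delta_mx 0 j) p = p 0 j.
Proof.
rewrite /dot (bigD1 j)//= mxE !eqxx mul1r big1 ?addr0// => i ij.
by rewrite mxE eqxx (negbTE ij) mul0r.
Qed.

Lemma normr_dot_le p v : `|dot p v| <= d%:R * `|p| * `|v|.
Proof.
apply: (le_trans (ler_norm_sum _ _ _)).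
apply: (@le_trans _ _ (\sum_(j < d) `|p| * `|v|)).
  by apply: ler_sum => j _; rewrite normrM ler_pM// coord_le_norm.
by rewrite sumr_const card_ord -mulrA mulr_natl.
Qed.

Lemma norm_le_enorm v : `|v| <= enorm v.
Proof.
rewrite [leLHS]/Num.norm/= mx_normrE; apply/bigmax_leP; split=> [|[i j] _ /=].
  exact: sqrtr_ge0.
rewrite (ord1 i) -sqrtr_sqr /enorm ler_sqrt; last first.
  by apply: sumr_ge0 => k _; rewrite -expr2 sqr_ge0.
rewrite /dot (bigD1 j)//= -expr2 lerDl.
by apply: sumr_ge0 => k _; rewrite -expr2 sqr_ge0.
Qed.

Lemma dot_continuous p : continuous (dot p).
Proof.
rewrite (_ : dot p = fun w : 'rV[R]_d => \sum_j p 0 j * w 0 j)//.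
apply: continuous_big => [|j _ v]; first exact: add_continuous.
exact: (continuous_comp (@coord_continuous R 1 d 0 j v)
  (@mulrl_continuous R (p 0 j) (v 0 j))).
Qed.

Lemma closed_norm_le (M : R) : closed [set v : 'rV[R]_d | `|v| <= M].
Proof.
apply: (@closed_comp _ _ (fun v : 'rV[R]_d => `|v|) [set y | y <= M]).
  by move=> v _; exact: norm_continuous.
exact: closed_le.
Qed.

Lemma compact_norm_le (M : R) : compact [set v : 'rV[R]_d | `|v| <= M].
Proof.
apply: bounded_closed_compact (@closed_norm_le _).
by exists M; split => [|N MN v /= vM]; rewrite ?num_real// (le_trans vM) ?ltW.
Qed.

End DotAndNorms.

(** * Legendre duality *)

Section Legendre.
Variables (R : realType) (d : nat).
Variable L : 'rV[R]_d * R * 'rV[R]_d -> R.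
Hypothesis hL : lagrangian L.

Let LC2 : C2 L. Proof. by case: hL. Qed.
Let Lcont : continuous L. Proof. by case: LC2. Qed.
Let Lderive u : (forall z, derivable L z u) /\ continuous ('D_u L).
Proof. by case: LC2. Qed.
Let Lderive2 u v : (forall z, derivable ('D_u L) z v) /\ continuous ('D_v ('D_u L)).
Proof. by case: LC2. Qed.

Definition vertical (v : 'rV[R]_d) : 'rV[R]_d * R * 'rV[R]_d := (0, 0, v).

Lemma verticalE v : vertical v = \sum_j v 0 j *: dir_zeta R j.
Proof.
transitivity (vertical (\sum_j v 0 j *: delta_mx 0 j)).
  by rewrite -row_sum_delta.
rewrite (big_morph vertical (id1 := 0) (op1 := +%R))//=.
  by apply: eq_bigr => j _; rewrite /vertical /dir_zeta; congr (_, _, _); rewrite scaler0.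
by move=> x y; rewrite /vertical; congr (_, _, _); rewrite addr0.
Qed.

Lemma derive_vertical v z :
  'D_(vertical v) L z = (\sum_j v 0 j *: 'D_(dir_zeta R j) L) z.
Proof.
rewrite verticalE derive_sum_dir// fct_sumE; exact: eq_bigr.
Qed.

(** The second derivative along a vertical direction is the quadratic form of
    [hess_zeta], because directional derivatives are linear in the direction. *)
Lemma derive2_vertical_gt0 v z : v != 0 ->
  0 < 'D_(vertical v) ('D_(vertical v) L) z.
Proof.
move=> v0; have [_ _ /(_ z v v0) + _ _] := hL.
rewrite mxE (_ : 'D_(vertical v) L = \sum_j v 0 j *: 'D_(dir_zeta R j) L); last first.
  by apply/funext => y; exact: derive_vertical.
rewrite derive_sum; last first.
  by move=> j; apply: derivableZ; exact: (Lderive2 _ _).1.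
rewrite (@eq_bigr _ _ _ _ _ _ _ (fun j => 'D_(vertical v) (v 0 j *: 'D_(dir_zeta R j) L) z))//.
move=> j _; rewrite deriveZ; last exact: (Lderive2 _ _).1.
rewrite verticalE derive_sum_dir; last by move=> u; exact: Lderive2.
rewrite !mxE [RHS]mulrC; congr (_ * _); apply: eq_bigr => i _.
by rewrite mxE.
Qed.

Lemma superlinear a : 0 <= a -> exists b : R, forall z, a * `|z.2| + b <= L z.
Proof.
move=> a0; have [_ _ _ /(_ a a0)[b Hb] _] := hL; exists b => z.
by rewrite (le_trans _ (Hb z))// lerD2r ler_wpM2l// norm_le_enorm.
Qed.

Variables (x : 'rV[R]_d) (t : R).
Implicit Types p q zeta : 'rV[R]_d.

Definition legendre_val p zeta := dot p zeta - L (x, t, zeta).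
Definition legendre_max p z := forall zeta, legendre_val p zeta <= legendre_val p z.

Lemma legendre_val_continuous p : continuous (legendre_val p).
Proof.
move=> z; apply: (@continuousB _ _ _ (dot p) (fun z => L (x, t, z)) z).
  exact: dot_continuous.
apply: (@continuous_comp _ _ _ (fun z : 'rV[R]_d => (x, t, z)) L); last exact: Lcont.
move=> A [[B1 B2] /= [hB1 hB2] hA]; apply: filterS hB2 => y By.
by apply: hA; split => //=; exact: nbhs_singleton hB1.
Qed.

(** Superlinear growth beats [dot p zeta] uniformly for bounded [p], so that all
    competitors far away lose against [zeta = 0]. *)
Lemma legendre_val_far (B : R) : 0 <= B ->
  exists2 M : R, 0 <= M & forall p zeta, `|p| <= B -> M < `|zeta| ->
    legendre_val p zeta < legendre_val p 0.
Proof.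
move=> B0; have [|b Hb] := @superlinear (d%:R * B + 1).
  by rewrite addr_ge0// mulr_ge0.
exists `|L (x, t, 0) - b| => // p zeta pB zM; rewrite /legendre_val dot0r sub0r.
have := Hb (x, t, zeta) => /= H.
have := normr_dot_le p zeta; rewrite ler_norml => /andP[_ dpz].
have h : d%:R * `|p| * `|zeta| <= d%:R * B * `|zeta|.
  by rewrite ler_wpM2r// ler_wpM2l.
have := ler_norm (L (x, t, 0) - b).
by lra.
Qed.

Lemma legendre_max_norm_le (B : R) : 0 <= B ->
  exists2 M : R, 0 <= M & forall p z, `|p| <= B -> legendre_max p z -> `|z| <= M.
Proof.
move=> B0; have [M M0 HM] := legendre_val_far B0; exists M => // p z pB zmax.
by rewrite leNgt; apply/negP => /(HM p z pB); rewrite ltNge zmax.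
Qed.

Lemma legendre_max_exists p : exists z, legendre_max p z.
Proof.
have [M M0 HM] := legendre_val_far (normr_ge0 p).
have ne : [set v : 'rV[R]_d | `|v| <= M] !=set0 by exists 0; rewrite /= normr0.
have [|z] := EVT_max_rV ne (@compact_norm_le _ _ M) (f := legendre_val p).
  by apply: continuous_subspaceT; exact: legendre_val_continuous.
rewrite inE /= => zM zmax; exists z => zeta.
have [zetaM|zetaM] := leP `|zeta| M; first by apply: zmax; rewrite inE.
rewrite (le_trans (ltW (HM p zeta (lexx _) zetaM)))// zmax// inE /=.
by rewrite normr0.
Qed.

(** Along the segment between two maximisers the derivative of the strictly
    concave function would vanish at both ends, against Rolle. *)
Lemma legendre_max_unique p z z' : legendre_max p z -> legendre_max p z' -> z = z'.
Proof.
move=> zmax zmax'; apply/eqP; rewrite -subr_eq0; apply: contraT => v0.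
set v := z - z' in v0.
pose w (s : R) : 'rV[R]_d * R * 'rV[R]_d := s *: vertical v + (x, t, z').
have wE s : w s = (x, t, s *: v + z').
  by rewrite /w /vertical; congr (_, _, _); rewrite /= scaler0 add0r.
pose g (s : R) := legendre_val p (s *: v + z').
pose g' (s : R) := dot p v - 'D_(vertical v) L (w s).
have dg (s : R) : is_derive s 1 g (g' s).
  have d1 : is_derive s 1 (fun s => s * dot p v + dot p z') (dot p v).
    by apply: is_derive_eq; rewrite /= addr0 scaler0 add0r [_ *: _]mulr1.
  have d2 := @is_derive_line R _ L (x, t, z') (vertical v) s ((Lderive _).1 _).
  have -> : g = (fun s => s * dot p v + dot p z') - (fun s => L (w s)).
    apply/funext => y.
    change (legendre_val p (y *: v + z') = y * dot p v + dot p z' - L (w y)).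
    by rewrite /legendre_val dotDr dotZr wE.
  exact: is_deriveB.
have dg' (s : R) : is_derive s 1 g' (- 'D_(vertical v) ('D_(vertical v) L) (w s)).
  have d2 := @is_derive_line R _ ('D_(vertical v) L) (x, t, z') (vertical v) s
    ((Lderive2 _ _).1 _).
  rewrite -[X in is_derive _ _ _ X]add0r.
  by apply: is_deriveB.
have crit s : (forall y, g y <= g s) -> g' s = 0.
  move=> smax.
  have le2 : s - 1 <= s + 1 by lra.
  have sin : s \in `](s - 1), (s + 1)[ by rewrite in_itv /=; apply/andP; split; lra.
  have gd (y : R) : y \in `](s - 1), (s + 1)[ -> derivable g y 1 by have [] := dg y.
  have [_ E] := derive1_at_max le2 gd sin (fun y _ => smax y).
  by have [_ <-] := dg s; rewrite E.
have g0 : g' 0 = 0 by apply: crit => y; rewrite /g scale0r add0r; exact: zmax'.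
have g1 : g' 1 = 0 by apply: crit => y; rewrite /g scale1r subrK; exact: zmax.
have [|||c _ [_ E]] := @Rolle R g' 0 1 ltr01.
- by move=> y _; have [] := dg' y.
- by apply: derivable_within_continuous => y _; have [] := dg' y.
- by rewrite g0 g1.
have [_ E'] := dg' c.
by have := derive2_vertical_gt0 (w c) v0; rewrite -[ltRHS]opprK -E' E oppr0 ltxx.
Qed.

(** By uniqueness the value on the compact set of velocities at distance at least
    [e] from [z] stays below the maximum by some [eta]; moving [p] by little changes
    no value in a bounded region by as much as [eta]. *)
Lemma legendre_max_continuous p z (e : R) : legendre_max p z -> 0 < e ->
  exists2 del : R, 0 < del & forall q z', `|q - p| <= del -> legendre_max q z' ->
    `|z' - z| < e.
Proof.
move=> zmax e0.
have B0 : 0 <= `|p| + 1 by rewrite addr_ge0.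
have [M M0 HM] := legendre_max_norm_le B0.
have zM : `|z| <= M by apply: HM zmax; rewrite lerDl.
pose A := [set v : 'rV[R]_d | `|v| <= M] `&` [set v : 'rV[R]_d | e <= `|v - z|].
have cA : compact A.
  apply: (subclosed_compact _ (@compact_norm_le R d M)); last by move=> v [].
  apply: closedI; first exact: closed_norm_le.
  rewrite (_ : [set v | _] = ~` ball z e); first exact/open_closedC/ball_open.
  apply/seteqP; split=> v /=; rewrite -ball_normE /= distrC => h.
    by rewrite ltNge h.
  by rewrite leNgt; apply/negP.
have qB q : `|q - p| <= 1 -> `|q| <= `|p| + 1.
  move=> qp; rewrite -(subrK p q) addrC (le_trans (ler_normD _ _))//.
  by rewrite lerD2l.
have [A0|/set0P/negP] := pselect (A !=set0); last first.
  rewrite negbK => /eqP A0; exists 1 => // q z' qp z'max.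
  rewrite ltNge; apply/negP => ez'; suff : A z' by rewrite A0.
  by split => //=; apply: HM z'max; exact: qB.
have [|z1] := EVT_max_rV A0 cA (f := legendre_val p).
  by apply: continuous_subspaceT; exact: legendre_val_continuous.
rewrite inE => -[z1M ez1] z1max.
pose eta := legendre_val p z - legendre_val p z1.
have eta0 : 0 < eta.
  rewrite subr_gt0 lt_neqAle zmax andbT; apply/eqP => E.
  have : z1 = z by apply: (@legendre_max_unique p) => // zeta; rewrite E.
  by move=> E1; move: ez1; rewrite /= E1 subrr normr0 leNgt e0.
have K0 : 0 < d%:R * (M + M) + 1 by rewrite ltr_wpDl// mulr_ge0// addr_ge0.
exists (Num.min 1 (eta / 2 / (d%:R * (M + M) + 1))).
  by rewrite lt_min ltr01 !divr_gt0.
move=> q z'; rewrite le_min => /andP[qp1 qp2] z'max.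
have z'M : `|z'| <= M by apply: HM z'max; exact: qB.
rewrite ltNge; apply/negP => ez'.
have /z1max le1 : z' \in A by rewrite inE.
have := z'max z; rewrite /legendre_val => le2.
have E zeta : dot q zeta = dot p zeta + dot (q - p) zeta.
  by rewrite -dotDl addrC subrK.
have le3 : `|dot (q - p) (z' - z)| <= eta / 2.
  rewrite (le_trans (normr_dot_le _ _))//.
  rewrite ler_pdivlMr// in qp2; apply: le_trans qp2.
  rewrite -mulrA mulrCA ler_wpM2l//.
  apply: (@le_trans _ _ (d%:R * (M + M))); last by rewrite lerDl.
  by rewrite ler_wpM2l// (le_trans (ler_normB _ _))// lerD.
move: le3; rewrite ler_norml => /andP[_]; rewrite dotDr dotNr.
move: le2; rewrite !E; move: le1 eta0; rewrite /eta /legendre_val.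
by lra.
Qed.

Lemma hamiltonianE p z : legendre_max p z ->
  hamiltonian L x t p = legendre_val p z.
Proof.
move=> zmax; rewrite /hamiltonian; apply/eqP; rewrite eq_le; apply/andP; split.
  apply: ge_sup; first by exists (legendre_val p z); exists z.
  by move=> _ [zeta _ <-]; exact: zmax.
apply: ub_le_sup; last by exists z.
by exists (legendre_val p z) => _ [zeta _ <-]; exact: zmax.
Qed.

Lemma hamiltonian_ge p zeta : legendre_val p zeta <= hamiltonian L x t p.
Proof. by have [z zmax] := legendre_max_exists p; rewrite (hamiltonianE zmax). Qed.

(** The difference quotient lies between the [j]-th coordinates of the maximisers at
    the two points, and these come together. *)
Lemma hamiltonian_derive p z j : legendre_max p z ->
  'D_(delta_mx 0 j) (hamiltonian L x t) p = z 0 j.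
Proof.
move=> zmax; apply/cvg_lim => //; apply/cvgrPdist_le => e e0.
have [del del0 Hdel] := legendre_max_continuous zmax e0.
near=> h.
have h0 : h != 0 by near: h; exact: nbhs_dnbhs_neq.
have [z' z'max] := legendre_max_exists (h *: delta_mx 0 j + p).
have z'z : `|z' - z| < e.
  apply: Hdel z'max; rewrite addrK normrZ.
  apply: (@le_trans _ _ `|h|).
    rewrite ler_piMr// [leLHS]/Num.norm/= mx_normrE; apply/bigmax_leP; split=> // -[a b] _ /=.
    by rewrite mxE; case: (_ && _); rewrite ?normr1 ?normr0.
  by apply: ltW; near: h; apply: dnbhs0_lt.
have z'zj : `|z' 0 j - z 0 j| <= e.
  apply: le_trans (ltW z'z); have := coord_le_norm (z' - z) j.
  by rewrite !mxE.
have E zeta : legendre_val (h *: delta_mx 0 j + p) zeta =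
    legendre_val p zeta + h * zeta 0 j.
  by rewrite /legendre_val dotDl dotZl dot_deltal; ring.
have l1 : legendre_val p z + h * z 0 j <= legendre_val p z' + h * z' 0 j.
  by rewrite -!E.
have l2 := zmax z'.
rewrite /= (hamiltonianE z'max) (hamiltonianE zmax) E.
apply: le_trans z'zj.
rewrite -(ler_pM2l (x := `|h|)) ?normr_gt0// -!normrM.
have -> : h * (z 0 j - h^-1 *: (legendre_val p z' + h * z' 0 j - legendre_val p z))
   = h * z 0 j - (legendre_val p z' + h * z' 0 j - legendre_val p z).
  by rewrite mulrBr [_ *: _]mulrC [h * (_ * _)]mulrC mulfVK.
rewrite mulrBr ler_norml; have := ler_norm (h * z' 0 j - h * z 0 j).
by move=> ?; apply/andP; split; lra.
Unshelve. all: by end_near. Qed.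

(** Turns bounds on [hamiltonian_p] into bounds on optimal velocities. *)
Lemma legendre_max_hamiltonian_p p : legendre_max p (hamiltonian_p L x t p).
Proof.
have [z zmax] := legendre_max_exists p.
rewrite (_ : hamiltonian_p L x t p = z)//; apply/rowP => j; rewrite mxE.
exact: hamiltonian_derive.
Qed.

Lemma fenchel_eq p : hamiltonian L x t p =
  dot p (hamiltonian_p L x t p) - L (x, t, hamiltonian_p L x t p).
Proof. by rewrite (hamiltonianE (@legendre_max_hamiltonian_p p)). Qed.

End Legendre.

(** * Parity classes of the grid *)

Section Parity.
Variables d N K : nat.
Implicit Types (m : 'rV[int]_d) (k : int).

Lemma dvdz2D1 (n : int) : (2 %| n + 1)%Z = ~~ (2 %| n)%Z.
Proof. by apply/idP/idP; lia. Qed.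

Lemma dvdz2_sign (n : int) (b : bool) : (2 %| n + (-1) ^+ b)%Z = ~~ (2 %| n)%Z.
Proof. by case: b; rewrite ?expr1 ?expr0; apply/idP/idP; lia. Qed.

Lemma coord_sumD m m' : \sum_j (m + m') 0 j = \sum_j m 0 j + \sum_j m' 0 j.
Proof. by rewrite -big_split; apply: eq_bigr => j _; rewrite mxE. Qed.

Lemma coord_sum_delta (a : int) (i : 'I_d) : \sum_j (a *: delta_mx 0 i : 'rV[int]_d) 0 j = a.
Proof.
rewrite (bigD1 i)//= !mxE !eqxx mulr1 big1 ?addr0// => j ji.
by rewrite !mxE (negbTE ji) andbF mulr0.
Qed.

Lemma coord_sum_omega (b : jump d) : \sum_j omega b 0 j = (-1) ^+ b.2.
Proof. exact: coord_sum_delta. Qed.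

Lemma on_Gt_omega m k b : on_Gt (m + omega b) k = on_G m k.
Proof.
rewrite /on_Gt /on_G coord_sumD coord_sum_omega addrAC dvdz2_sign.
by rewrite negbK.
Qed.

Lemma on_GE m k : on_G m k = ~~ on_Gt m k.
Proof. by rewrite negbK. Qed.

Lemma on_GtS m k : on_Gt m (k + 1) = on_G m k.
Proof. by rewrite /on_Gt /on_G addrA dvdz2D1 negbK. Qed.

Lemma on_Gt0 m : on_Gt m 0 = odd_pt m.
Proof. by rewrite /on_Gt /on_G addr0. Qed.

Lemma on_Gt_time m k (q : int) : on_Gt m (k + (2 * K)%:Z * q) = on_Gt m k.
Proof.
rewrite /on_Gt /on_G addrA; congr (~~ _); apply/idP/idP; lia.
Qed.

Lemma space_periodE (j : 'I_d) : space_period N j = (2 * N)%:Z *: delta_mx 0 j.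
Proof. by rewrite /space_period -scaler_nat natz. Qed.

Lemma on_Gt_space m k j : on_Gt (m + space_period N j) k = on_Gt m k.
Proof.
rewrite /on_Gt /on_G coord_sumD space_periodE coord_sum_delta addrAC.
by congr (~~ _); apply/idP/idP; lia.
Qed.

End Parity.

(** * One step of the scheme *)

Section StepEstimates.
Variables (R : realType) (d N K : nat).
Hypothesis hd : (0 < d)%N.
Variable L : 'rV[R]_d * R * 'rV[R]_d -> R.
Hypothesis hL : lagrangian L.
Variable c : 'rV[R]_d.
Implicit Types (m : 'rV[int]_d) (zeta : 'rV[R]_d) (w : 'rV[int]_d -> R).

Local Notation h := (hstep R N).
Local Notation tau := (tstep R K).
Local Notation lam := (mesh_ratio R N K).
Local Notation jp := (jump_proba N K).

Let d0 : d%:R != 0 :> R. Proof. by rewrite pnatr_eq0 -lt0n. Qed.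

Lemma jump_probaE zeta (j : 'I_d) (b : bool) :
  jp zeta (j, b) = (2 * d)%:R^-1 - lam / 2 * ((-1) ^+ b * zeta 0 j).
Proof.
rewrite /jump_proba /omega/=; congr (_ - _ * _).
rewrite (_ : map_mx _ _ = (-1) ^+ b *: delta_mx 0 j); first by rewrite dotZl dot_deltal.
apply/rowP => i; rewrite !mxE rmorphM/= rmorphXn/= rmorphN1.
by rewrite rmorph_nat.
Qed.

Lemma sum_jump (F : jump d -> R) :
  \sum_b F b = \sum_j (F (j, true) + F (j, false)).
Proof.
transitivity (\sum_(p : 'I_d * bool) F (p.1, p.2)).
  by apply: eq_bigr => -[].
rewrite -(pair_bigA _ (fun j b => F (j, b)))/=.
by apply: eq_bigr => j _; rewrite big_bool.
Qed.

Lemma sum_jump_proba zeta : \sum_b jp zeta b = 1.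
Proof.
rewrite sum_jump (eq_bigr (fun _ => d%:R^-1)); last first.
  by move=> j _; rewrite !jump_probaE natrM; field.
by rewrite sumr_const card_ord -[LHS]mulr_natl divff.
Qed.

Lemma jump_proba_ge zeta (A : R) b : 0 <= lam -> `|zeta| <= A ->
  (2 * d)%:R^-1 - lam / 2 * A <= jp zeta b.
Proof.
move=> lam0 zA; case: b => j b; rewrite jump_probaE lerB// ler_wpM2l//.
  by rewrite divr_ge0.
apply: le_trans zA; apply: le_trans (coord_le_norm zeta j).
by apply: (le_trans (ler_norm _)); rewrite normrM normrX normrN1 expr1n mul1r.
Qed.

(** The link between the scheme and the walk: subtracting the drift reweights the
    neighbours with the jump probabilities of velocity [zeta]. *)
Lemma neighbour_mean_drift w m zeta :
  neighbour_mean w m - tau * dot (Dx N w m) zeta =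
  \sum_b jp zeta b * w (m + omega b).
Proof.
have -> : neighbour_mean w m = \sum_b (2 * d)%:R^-1 * w (m + omega b).
  by rewrite /neighbour_mean mulr_sumr.
rewrite !sum_jump /dot mulr_sumr -sumrB; apply: eq_bigr => j _.
rewrite !jump_probaE !mxE /omega /= expr1 expr0 scaleN1r scale1r.
rewrite /mesh_ratio invfM; ring.
Qed.

Definition scheme_step (k : int) w m : R :=
  neighbour_mean w m - tau * hamiltonian L (xpt R N m) (tpt R K k) (c + Dx N w m).

Definition optimal_velocity (k : int) w m : 'rV[R]_d :=
  hamiltonian_p L (xpt R N m) (tpt R K k) (c + Dx N w m).

(** The Fenchel inequality for the velocity [zeta]. *)
Lemma scheme_step_le k w m zeta : 0 <= tau ->
  scheme_step k w m <=
  tau * lagrangian_c L c (xpt R N m) (tpt R K k) zeta + \sum_b jp zeta b * w (m + omega b).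
Proof.
move=> tau0; rewrite -neighbour_mean_drift /scheme_step.
have := hamiltonian_ge hL (xpt R N m) (tpt R K k) (c + Dx N w m) zeta.
move=> /(ler_wpM2l tau0); rewrite /legendre_val /lagrangian_c dotDl; lra.
Qed.

(** Equality in the Fenchel inequality. *)
Lemma scheme_step_eq k w m : scheme_step k w m =
  tau * lagrangian_c L c (xpt R N m) (tpt R K k) (optimal_velocity k w m)
  + \sum_b jp (optimal_velocity k w m) b * w (m + omega b).
Proof.
rewrite -neighbour_mean_drift /scheme_step fenchel_eq//.
by rewrite /optimal_velocity /lagrangian_c dotDl; ring.
Qed.

(** Using the velocity that is optimal for [w] as a competitor for [w'] bounds
    the difference of the two steps below by a weighted mean of [w - w']. *)
Lemma scheme_step_diff k w w' m : 0 <= tau ->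
  \sum_b jp (optimal_velocity k w m) b * (w (m + omega b) - w' (m + omega b))
  <= scheme_step k w m - scheme_step k w' m.
Proof.
move=> tau0; have := scheme_step_le k w' m (optimal_velocity k w m) tau0.
rewrite (scheme_step_eq k w m).
under [in X in _ -> X]eq_bigr do rewrite mulrBr.
by rewrite sumrB; lra.
Qed.

Lemma phiS v (k : nat) : phi N K L c v k.+1 = scheme_step k (phi N K L c v k).
Proof. by []. Qed.

End StepEstimates.

(** * Periods of the grid and reachability *)

Section SpacePeriodicity.
Variables d N : nat.
Implicit Types (m : 'rV[int]_d) (k : int).

Lemma sum_delta_row (S : nzRingType) (a : 'I_d -> S) :
  \sum_j a j *: delta_mx 0 j = \row_j a j :> 'rV[S]_d.
Proof.
rewrite [RHS]row_sum_delta; apply: eq_bigr => j _; congr (_ *: _).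
by rewrite mxE.
Qed.

Lemma periodic_sum (T : Type) (u : 'rV[int]_d -> T) k (a : 'I_d -> int) m :
  (forall m j, on_Gt m k -> u (m + space_period N j) = u m) ->
  on_Gt m k -> u (m + \sum_j space_period N j *~ a j) = u m.
Proof.
move=> up mk.
have one (j : 'I_d) (i : int) m' : on_Gt m' k ->
    on_Gt (m' + space_period N j *~ i) k /\
    u (m' + space_period N j *~ i) = u m'.
  elim/int_rec: i m' => [|n IH|n IH] m' m'k.
  - by rewrite mulr0z addr0.
  - rewrite intS mulrzDr mulr1z addrA.
    have m''k : on_Gt (m' + space_period N j) k by rewrite on_Gt_space.
    by have [-> ->] := IH _ m''k; rewrite up.
  - rewrite intS opprD mulrzDr mulrN1z addrA.
    have m''k : on_Gt (m' - space_period N j) k.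
      by rewrite -(@on_Gt_space d N _ _ j) subrK.
    by have [-> ->] := IH _ m''k; rewrite -(up _ j m''k) subrK.
suff H (s : seq 'I_d) m' : on_Gt m' k ->
    u (m' + \sum_(j <- s) space_period N j *~ a j) = u m' by exact: H.
elim: s m' => [|j s IH] m' m'k; first by rewrite big_nil addr0.
by rewrite big_cons addrA; have [mk' um'] := one j (a j) _ m'k; rewrite IH.
Qed.

(** The bound [(2 * N).-1.+1], equal to [2 * N] for positive [N], has the successor
    form that [inord] asks for. *)
Definition reduce_index m : {ffun 'I_d -> 'I_(2 * N).-1.+1} :=
  [ffun j => inord `|(m ord0 j %% (2 * N)%:Z)%Z|%N].

Definition lift_index (f : {ffun 'I_d -> 'I_(2 * N).-1.+1}) : 'rV[int]_d :=
  \row_j (f j : nat)%:Z.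

Lemma reduce_indexE m : (0 < N)%N -> m = lift_index (reduce_index m) +
  \sum_j space_period N j *~ (m ord0 j %/ (2 * N)%:Z)%Z.
Proof.
move=> N0; have N2 : (2 * N)%:Z != 0 by lia.
rewrite [X in _ + X](_ : _ = \sum_j ((m ord0 j %/ (2 * N)%:Z)%Z * (2 * N)%:Z) *: delta_mx 0 j).
  rewrite sum_delta_row; apply/rowP => j; rewrite !mxE ffunE inordK.
    rewrite gez0_abs ?modz_ge0// addrC; exact: divz_eq.
  have := ltz_pmod (m 0 j) (d := (2 * N)%:Z); have := modz_ge0 (m 0 j) N2.
  lia.
by apply: eq_bigr => j _; rewrite space_periodE -scaler_int scalerA intz.
Qed.

Lemma periodic_reduce (T : Type) (u : 'rV[int]_d -> T) k m : (0 < N)%N ->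
  (forall m j, on_Gt m k -> u (m + space_period N j) = u m) -> on_Gt m k ->
  on_Gt (lift_index (reduce_index m)) k /\ u (lift_index (reduce_index m)) = u m.
Proof.
move=> N0 up mk; have E := reduce_indexE m N0; set f := reduce_index m in E *.
have fk : on_Gt (lift_index f) k.
  rewrite (_ : lift_index f = m + \sum_j space_period N j *~ (- (m ord0 j %/ (2 * N)%:Z)%Z)).
    rewrite -[on_Gt _ _]/((fun m => on_Gt m k) _) (@periodic_sum _ _ k)//.
    by move=> m' j _; rewrite on_Gt_space.
  under eq_bigr do rewrite mulrNz.
  by rewrite sumrN {1}E addrK.
by split=> //; rewrite [in RHS]E (@periodic_sum _ _ k).
Qed.

(** A function on one parity class of a periodic grid takes finitely many values. *)
Lemma periodic_bounded (R : realType) (u : 'rV[int]_d -> R) k : (0 < N)%N ->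
  (forall m j, on_Gt m k -> u (m + space_period N j) = u m) ->
  exists M : R, forall m, on_Gt m k -> `|u m| <= M.
Proof.
move=> N0 up; exists (\sum_f `|u (lift_index f)|) => m mk.
have [_ <-] := periodic_reduce N0 up mk.
by rewrite (bigD1 (reduce_index m))//= lerDl sumr_ge0.
Qed.

(** Up to periods [n] is reached from [m] by at most [2 N d] forward unit jumps;
    the remaining jumps, even in number by parity, are spent going back and
    forth. *)
Lemma reach_in_exactly (l : nat) m n : (0 < N)%N -> (0 < d)%N -> odd_pt m -> odd_pt n ->
  (2 * N * d <= l)%N -> ~~ odd l ->
  exists (p : seq (jump d)) (a : 'I_d -> int), size p = l /\
    m + \sum_(b <- p) omega b = n + \sum_j space_period N j *~ a j.
Proof.
move=> N0 d0 modd nodd ll lodd; have N2 : (2 * N)%:Z != 0 by lia.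
pose e j : int := n 0 j - m 0 j.
pose q j := (e j %/ (2 * N)%:Z)%Z.
pose s j := `|(e j %% (2 * N)%:Z)%Z|%N.
have sE j : (s j)%:Z = e j - q j * (2 * N)%:Z.
  by rewrite /s gez0_abs ?modz_ge0.
have s_lt j : (s j <= 2 * N)%N.
  have := ltz_pmod (e j) (d := (2 * N)%:Z); have := modz_ge0 (e j) N2.
  by rewrite /s; lia.
(* for each [j], the forward jumps in direction [j] that correct coordinate [j] modulo the period *)
pose p1 := flatten [seq nseq (s j) (j, false) | j <- enum 'I_d].
have size_p1 : size p1 = (\sum_j s j)%N.
  rewrite size_flatten /shape -map_comp sumnE big_map big_enum/=.
  by apply: eq_bigr => j _; rewrite size_nseq.
have sum_p1 : \sum_(b <- p1) omega b = \row_j (s j)%:Z.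
  rewrite big_flatten big_map big_enum/= -sum_delta_row; apply: eq_bigr => j _.
  rewrite big_nseq iter_addr_0 /omega/= expr0 scale1r.
  by rewrite -scaler_nat natz.
have size_le : (size p1 <= l)%N.
  rewrite size_p1 (leq_trans _ ll)//.
  apply: (@leq_trans (\sum_(j < d) (2 * N))); first exact: leq_sum.
  by rewrite sum_nat_const card_ord mulnC.
have size_even : ~~ odd (size p1).
  have H : (size p1)%:Z = \sum_j n 0 j - \sum_j m 0 j - 2 * (N%:Z * \sum_j q j).
    rewrite size_p1 (big_morph Posz (id1 := 0) (op1 := +%R))//.
    rewrite !mulr_sumr -!sumrB; apply: eq_bigr => j _.
    by rewrite sE /e PoszM; ring.
  move: modd nodd; rewrite /odd_pt /even_pt; move: H.
  generalize (\sum_j m 0 j), (\sum_j n 0 j), (N%:Z * \sum_j q j) => A B C.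
  by lia.
(* the idle part, alternating forward and backward jumps *)
pose i0 := Ordinal d0.
pose k := ((l - size p1)./2)%N.
pose p2 := flatten (nseq k [:: (i0, false); (i0, true)]).
have size_p2 : size p2 = (l - size p1)%N.
  rewrite size_flatten /shape map_nseq sumn_nseq/= /k; move: size_le lodd size_even.
  lia.
have sum_p2 : \sum_(b <- p2) omega b = 0.
  rewrite big_flatten big_nseq; elim: k {size_p2 p2} => //= k ->.
  by rewrite !big_cons big_nil /omega/= expr1 expr0 scale1r scaleN1r !addr0 subrr.
exists (p1 ++ p2), (fun j => - q j); split.
  by rewrite size_cat size_p2 subnKC.
rewrite big_cat/= sum_p1 sum_p2 addr0.
have -> : \sum_j space_period N j *~ (- q j) = \row_j (- q j * (2 * N)%:Z).
  rewrite -sum_delta_row; apply: eq_bigr => j _.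
  by rewrite space_periodE -scaler_int scalerA intz.
apply/rowP => j; rewrite !mxE sE /e; ring.
Qed.

End SpacePeriodicity.

(** * Invariances of the scheme *)

Section Periodicity.
Variables (R : realType) (d N K : nat).
Hypotheses (hN : (0 < N)%N) (hK : (0 < K)%N).
Variable L : 'rV[R]_d * R * 'rV[R]_d -> R.
Hypothesis hL : lagrangian L.
Implicit Types (m : 'rV[int]_d) (k : int).

Lemma lagrangian_space (x : 'rV[R]_d) (a : 'I_d -> int) t zeta :
  L (x + \row_j (a j)%:~R, t, zeta) = L (x, t, zeta).
Proof.
have [[Lx _] _ _ _ _] := hL.
have one (j : 'I_d) (i : int) y : L (y + (i%:~R : R) *: delta_mx 0 j, t, zeta) = L (y, t, zeta).
  elim/int_rec: i y => [|n IH|n IH] y; first by rewrite scale0r addr0.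
    by rewrite intS rmorphD/= scalerDl scale1r addrA IH Lx.
  rewrite intS opprD rmorphD/= scalerDl addrA IH.
  by rewrite -(Lx j (y + _)) rmorphN1 scaleN1r subrK.
rewrite -sum_delta_row.
suff H (s : seq 'I_d) y :
  L (y + \sum_(j <- s) ((a j)%:~R : R) *: delta_mx 0 j, t, zeta) = L (y, t, zeta) by exact: H.
elim: s y => [|j s IH] y; first by rewrite big_nil addr0.
by rewrite big_cons addrA IH one.
Qed.

Lemma lagrangian_time x (t : R) (q : int) zeta :
  L (x, t + q%:~R, zeta) = L (x, t, zeta).
Proof.
have [[_ Lt] _ _ _ _] := hL.
elim/int_rec: q t => [|n IH|n IH] t; first by rewrite addr0.
  by rewrite intS rmorphD/= addrA IH Lt.
by rewrite intS opprD rmorphD/= addrA IH -(Lt x (t + _)) subrK.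
Qed.

Lemma hamiltonian_time x (t : R) (q : int) :
  hamiltonian L x (t + q%:~R) = hamiltonian L x t.
Proof.
apply/funext => p; congr (sup _); apply: eq_imagel => zeta _.
by rewrite lagrangian_time.
Qed.

Lemma hstep_gt0 : 0 < hstep R N.
Proof. by rewrite invr_gt0 ltr0n muln_gt0. Qed.

Lemma tstep_gt0 : 0 < tstep R K.
Proof. by rewrite invr_gt0 ltr0n muln_gt0. Qed.

Lemma tpt_gt0 (l : nat) : (0 < l)%N -> 0 < tpt R K l.
Proof. by move=> l0; rewrite mulr_gt0 ?tstep_gt0// ltr0z ltz_nat. Qed.

Lemma mesh_ratio_gt0 : 0 < mesh_ratio R N K.
Proof. by rewrite divr_gt0 ?tstep_gt0 ?hstep_gt0. Qed.

Lemma xpt_space m j : xpt R N (m + space_period N j) = xpt R N m + delta_mx 0 j.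
Proof.
rewrite /xpt map_mxD scalerDr space_periodE; congr (_ + _).
apply/rowP => i; rewrite !mxE eqxx /=; case: (i == j); last by rewrite !mulr0.
by rewrite mulr1 /hstep mulVf// pnatr_eq0 muln_eq0 /= -lt0n.
Qed.

Lemma tpt_time k (q : int) : tpt R K (k + (2 * K)%:Z * q) = tpt R K k + q%:~R.
Proof.
rewrite /tpt rmorphD rmorphM/= mulrDr mulrA mulVf ?mul1r//.
by rewrite pnatr_eq0 muln_eq0 /= -lt0n.
Qed.

Lemma hamiltonian_space m j t :
  hamiltonian L (xpt R N (m + space_period N j)) t = hamiltonian L (xpt R N m) t.
Proof.
apply/funext => p; congr (sup _); apply: eq_imagel => zeta _.
have [[Lx _] _ _ _ _] := hL.
by rewrite xpt_space Lx.
Qed.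

Variable c : 'rV[R]_d.
Implicit Types v w : 'rV[int]_d -> R.

Lemma scheme_step_time k (q : int) w :
  scheme_step N K L c (k + (2 * K)%:Z * q) w = scheme_step N K L c k w.
Proof.
by apply/funext => m; rewrite /scheme_step tpt_time hamiltonian_time.
Qed.

Lemma omega_false (j : 'I_d) : omega (j, false) = delta_mx 0 j.
Proof. by rewrite /omega /= expr0 scale1r. Qed.

Lemma omega_true (j : 'I_d) : omega (j, true) = - delta_mx 0 j.
Proof. by rewrite /omega /= expr1 scaleN1r. Qed.

(** One statement for three uses: adding a constant, translating by a period, and
    changing values off the neighbours of a point. *)
Lemma Dx_shift w w' m m' (s : R) :
  (forall b, w (m + omega b) = w' (m' + omega b) + s) -> Dx N w m = Dx N w' m'.
Proof.
move=> H; apply/rowP => j; rewrite !mxE -omega_true -omega_false !H.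
by congr (_ / _); rewrite opprD addrACA subrr addr0.
Qed.

Lemma neighbour_mean_shift w w' m m' (s : R) : (0 < d)%N ->
  (forall b, w (m + omega b) = w' (m' + omega b) + s) ->
  neighbour_mean w m = neighbour_mean w' m' + s.
Proof.
move=> d0 H; rewrite /neighbour_mean.
under eq_bigr do rewrite H.
rewrite big_split/= mulrDr; congr (_ + _).
rewrite sumr_const card_prod card_ord card_bool -[X in _ * X]mulr_natl mulrA.
by rewrite [(d * 2)%N]mulnC mulVf ?mul1r// pnatr_eq0 muln_eq0 /= -lt0n.
Qed.

Lemma scheme_step_shift k w w' m (s : R) : (0 < d)%N ->
  (forall b, w (m + omega b) = w' (m + omega b) + s) ->
  scheme_step N K L c k w m = scheme_step N K L c k w' m + s.
Proof.
move=> d0 H; rewrite /scheme_step (neighbour_mean_shift d0 H) (Dx_shift H); ring.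
Qed.

Lemma phi_shift v v' (s : R) (k : nat) m : (0 < d)%N ->
  (forall m, odd_pt m -> v m = v' m + s) -> on_Gt m k ->
  phi N K L c v k m = phi N K L c v' k m + s.
Proof.
move=> d0 H; elim: k m => [|k IH] m mk; first by apply: H; rewrite -on_Gt0.
rewrite !phiS; apply: scheme_step_shift => // b; apply: IH.
by rewrite on_Gt_omega -on_GtS -addn1 PoszD in mk *.
Qed.

Lemma phi_time v (q k : nat) :
  phi N K L c v (2 * K * q + k) = phi N K L c (phi N K L c v (2 * K * q)) k.
Proof.
elim: k => [|k IH]; first by rewrite addn0.
by rewrite addnS !phiS IH PoszD PoszM addrC scheme_step_time.
Qed.

Lemma phi_space v (k : nat) m j : (0 < d)%N ->
  (forall m j, odd_pt m -> v (m + space_period N j) = v m) -> on_Gt m k ->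
  phi N K L c v k (m + space_period N j) = phi N K L c v k m.
Proof.
move=> d0 H; elim: k m => [|k IH] m mk; first by apply: H; rewrite -on_Gt0.
have H' b : phi N K L c v k (m + space_period N j + omega b) =
    phi N K L c v k (m + omega b) + 0.
  rewrite addr0 addrAC; apply: IH.
  by rewrite on_Gt_omega -on_GtS -addn1 PoszD in mk *.
rewrite !phiS /scheme_step (neighbour_mean_shift d0 H') addr0 (Dx_shift H').
by rewrite hamiltonian_space.
Qed.

End Periodicity.

(** * Geometric sequences *)

Section GeometricSequences.
Variable R : realType.

Lemma geometric_le0 (x A q : R) : 0 <= q < 1 -> (forall j : nat, x <= A * q ^+ j) -> x <= 0.
Proof.
move=> /andP[q0 q1] H.
have q1' : `|q| < 1 by rewrite ger0_norm.
have /cvg_lim <- // := @cvg_geometric R A q q1'.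
apply: limr_ge; first by apply/cvg_ex; exists 0; exact: cvg_geometric.
by apply: nearW => n; exact: H.
Qed.

Lemma geometric_eq0 (x A q : R) : 0 <= q < 1 -> (forall j : nat, `|x| <= A * q ^+ j) -> x = 0.
Proof.
move=> q01 H; apply/eqP; rewrite -normr_eq0 eq_le normr_ge0 andbT.
exact: (geometric_le0 q01 H).
Qed.

(** [u j + E q ^ j] decreases and [u j - E q ^ j] increases for
    [E = C / (1 - q)], so that the infimum of the former is the limit. *)
Lemma geometric_limit (u : nat -> R) (C q : R) : 0 <= q < 1 ->
  (forall j, `|u j.+1 - u j| <= C * q ^+ j) ->
  exists l, forall j, `|l - u j| <= C / (1 - q) * q ^+ j.
Proof.
move=> /andP[q0 q1] H; set E := C / (1 - q).
have EC : E = C + E * q by rewrite /E; field; rewrite subr_eq0 gt_eqF.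
pose U j := u j + E * q ^+ j; pose D j := u j - E * q ^+ j.
have C0 : 0 <= C by have := le_trans (normr_ge0 _) (H 0%N); rewrite expr0 mulr1.
have E0 : 0 <= E by rewrite divr_ge0// subr_ge0 ltW.
have EqS j : E * q ^+ j = C * q ^+ j + E * q ^+ j.+1.
  by rewrite {1}EC exprS; ring.
have US j : U j.+1 <= U j.
  by have := H j; rewrite ler_norml /U (EqS j) => /andP[_]; lra.
have DS j : D j <= D j.+1.
  by have := H j; rewrite ler_norml /D (EqS j) => /andP[+ _]; lra.
have Ui i j : (i <= j)%N -> U j <= U i.
  by move=> ij; have := @homo_leq _ (U : nat -> R) (fun a b => b <= a) (fun x => lexx x)
    (fun y x z (xy : y <= x) (yz : z <= y) => le_trans yz xy) US _ _ ij.
have Di i j : (i <= j)%N -> D i <= D j.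
  by move=> ij; have := @homo_leq _ (D : nat -> R) (fun a b => a <= b) (fun x => lexx x)
    (fun y x z (xy : x <= y) (yz : y <= z) => le_trans xy yz) DS _ _ ij.
have DU i j : D i <= U j.
  apply: (@le_trans _ _ (D (maxn i j))); first by rewrite Di// leq_maxl.
  apply: (@le_trans _ _ (U (maxn i j))); last by rewrite Ui// leq_maxr.
  have : 0 <= E * q ^+ (maxn i j) by rewrite mulr_ge0// exprn_ge0.
  by rewrite /D /U; lra.
exists (inf (range U)) => j; rewrite ler_norml.
have le1 : inf (range U) <= U j.
  by apply: ge_inf; [exists (D 0%N) => _ [i _ <-]; exact: DU|exists j].
have le2 : D j <= inf (range U).
  by apply: lb_le_inf; [exists (U 0%N); exists 0%N|move=> _ [i _ <-]; exact: DU].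
by move: le1 le2; rewrite /U /D => *; apply/andP; split; lra.
Qed.

End GeometricSequences.

(** * Existence of the effective Hamiltonian *)

Section EffectiveHamiltonian.
Variables (R : realType) (d N K : nat).
Hypotheses (hd : (0 < d)%N) (hN : (0 < N)%N) (hK : (0 < K)%N).
Variable L : 'rV[R]_d * R * 'rV[R]_d -> R.
Hypothesis hL : lagrangian L.
Variables (r lambda1 : R) (c : 'rV[R]_d).
Hypotheses (hr : 0 < r) (hlambda1 : 0 < lambda1) (hlambda : mesh_ratio R N K < lambda1).
Hypothesis hstable : forall v, Xdelta N r v -> Xdelta N r (phi N K L c v (2 * K)).
Hypothesis hCFL : forall v, Xdelta N r v -> forall (k : nat) m, on_G m k ->
  `|optimal_velocity N K L c k (phi N K L c v k) m| <= (d%:R * lambda1)^-1.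
Implicit Types (m : 'rV[int]_d) (v w : 'rV[int]_d -> R).

Local Notation lam := (mesh_ratio R N K).
Local Notation jp := (jump_proba N K).
Local Notation phi := (phi N K L c).
Local Notation X := (Xdelta N r).

(** Lower bound of the jump probabilities for velocities satisfying the CFL bound;
    it is positive because [lam < lambda1] is strict. *)
Let rho : R := (2 * d)%:R^-1 - lam / 2 * (d%:R * lambda1)^-1.

Let d0 : 0 < d%:R :> R. Proof. by rewrite ltr0n. Qed.
Let lam0 : 0 < lam. Proof. exact: mesh_ratio_gt0. Qed.
Let tau0 : 0 <= tstep R K. Proof. exact/ltW/tstep_gt0. Qed.

Let rho_gt0 : 0 < rho.
Proof.
have -> : rho = (2 * d)%:R^-1 * (1 - lam / lambda1).
  rewrite /rho natrM; field; rewrite !gt_eqF//.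
apply: mulr_gt0; first by rewrite invr_gt0 natrM mulr_gt0.
by rewrite subr_gt0 ltr_pdivrMr// mul1r.
Qed.

Let rho_lt1 : rho < 1.
Proof.
have : (2 * d)%:R^-1 < 1 :> R by rewrite invf_lt1 ?ltr1n ?ltr0n; lia.
have : 0 < lam / 2 * (d%:R * lambda1)^-1.
  by apply: divr_gt0; [apply: divr_gt0|apply: mulr_gt0].
by rewrite /rho; lra.
Qed.

Lemma jump_mean_ge zeta (F : jump d -> R) (a : R) b0 :
  `|zeta| <= (d%:R * lambda1)^-1 -> (forall b, a <= F b) ->
  a + rho * (F b0 - a) <= \sum_b jp zeta b * F b.
Proof.
move=> zl aF.
have jpr b : rho <= jp zeta b by apply: jump_proba_ge zl; exact: ltW.
have -> : \sum_b jp zeta b * F b = a + \sum_b jp zeta b * (F b - a).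
  under [in RHS]eq_bigr do rewrite mulrBr.
  by rewrite sumrB -mulr_suml sum_jump_proba// mul1r addrC subrK.
rewrite lerD2l (bigD1 b0)//= -[leLHS]addr0 lerD//.
  by rewrite ler_wpM2r// subr_ge0.
apply: sumr_ge0 => b _; apply: mulr_ge0; last by rewrite subr_ge0.
exact: le_trans (ltW rho_gt0) (jpr b).
Qed.

Lemma phi_diff_step v v' (k : nat) m b0 (a : R) : X v -> on_G m k ->
  (forall b, a <= phi v k (m + omega b) - phi v' k (m + omega b)) ->
  a + rho * (phi v k (m + omega b0) - phi v' k (m + omega b0) - a)
    <= phi v k.+1 m - phi v' k.+1 m.
Proof.
move=> Xv mk H; rewrite !phiS.
apply: le_trans (scheme_step_diff N hL c k _ _ m tau0).
exact: (jump_mean_ge b0 (hCFL Xv mk) H).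
Qed.

Let on_G_omega m (k : nat) b : on_Gt m k.+1 -> on_Gt (m + omega b) k.
Proof. by rewrite on_Gt_omega -on_GtS -addn1 PoszD. Qed.

Let on_Gt_succ m (k : nat) : on_Gt m k.+1 -> on_G m k.
Proof. by rewrite -on_GtS -addn1 PoszD. Qed.

(** Each step averages the difference of two solutions with positive weights, hence
    preserves lower bounds. *)
Lemma phi_diff_ge v v' (a : R) (k : nat) m : X v ->
  (forall m, odd_pt m -> a <= v m - v' m) -> on_Gt m k ->
  a <= phi v k m - phi v' k m.
Proof.
move=> Xv H; elim: k m => [|k IH] m mk; first by apply: H; rewrite -on_Gt0.
have H' b : a <= phi v k (m + omega b) - phi v' k (m + omega b).
  by apply: IH; exact: on_G_omega.
apply: le_trans (phi_diff_step (Ordinal hd, true) Xv (on_Gt_succ mk) H').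
by rewrite lerDl; apply: mulr_ge0; [exact: ltW|rewrite subr_ge0].
Qed.

(** Along a given path each jump has probability at least [rho], so that the excess
    over the lower bound at its end point is felt at its origin with the factor
    [rho ^+ size p]. *)
Lemma phi_diff_reach v v' (a : R) (p : seq (jump d)) m : X v ->
  (forall m, odd_pt m -> a <= v m - v' m) -> on_Gt m (size p) ->
  let n := m + \sum_(b <- p) omega b in
  a + rho ^+ size p * (v n - v' n - a) <= phi v (size p) m - phi v' (size p) m.
Proof.
move=> Xv H /=; elim: p m => [|b p IH] m mk /=.
  by rewrite big_nil addr0 expr0 mul1r addrC subrK.
have H' b' : a <= phi v (size p) (m + omega b') - phi v' (size p) (m + omega b').
  by apply: phi_diff_ge => //; exact: on_G_omega.
apply: le_trans (phi_diff_step b Xv (on_Gt_succ mk) H').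
rewrite lerD2l exprS -mulrA; apply: ler_wpM2l; first exact: ltW.
by rewrite lerBrDl big_cons addrA; apply: IH; exact: on_G_omega.
Qed.

(** Nonexpansiveness in the maximum norm, from monotonicity in both directions. *)
Lemma phi_dist_le v v' (e : R) (k : nat) m : X v -> X v' ->
  (forall m, odd_pt m -> `|v m - v' m| <= e) -> on_Gt m k ->
  `|phi v k m - phi v' k m| <= e.
Proof.
move=> Xv Xv' H mk; rewrite ler_norml; apply/andP; split.
  by apply: phi_diff_ge mk => // m' /H; rewrite ler_norml => /andP[].
rewrite -lerN2 opprB; apply: phi_diff_ge mk => // m' /H.
by rewrite distrC ler_norml => /andP[].
Qed.

Lemma Xdelta_cst v (s : R) : X v -> X (fun m => v m + s).
Proof.
move=> [Xp Xd]; split=> [m j modd|m meven]; first by rewrite Xp.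
suff -> : Dx N (fun m => v m + s) m = Dx N v m by exact: Xd.
exact: (@Dx_shift _ _ _ _ _ _ _ s).
Qed.

Lemma Xdelta0 : X (fun _ : 'rV[int]_d => 0).
Proof.
split=> // m _; rewrite (_ : Dx _ _ _ = 0) ?normr0 ?ltW//.
by apply/rowP => j; rewrite !mxE subrr mul0r.
Qed.

Lemma Xdelta_phi v (q : nat) : X v -> X (phi v (2 * K * q)).
Proof.
move=> Xv; elim: q => [|q IH]; first by rewrite muln0.
by rewrite mulnS addnC phi_time//; exact: hstable.
Qed.

(** Number of steps after which every point has been linked to every other. *)
Let steps := (2 * K * (N * d))%N.
Let T v := phi v steps.
Let theta := rho ^+ steps.
Let q := 1 - theta.

Let theta01 : 0 < theta <= 1.
Proof. by rewrite exprn_gt0//= exprn_ile1// ltW. Qed.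

Let q01 : 0 <= q < 1.
Proof. by move: theta01 => /andP[? ?]; rewrite /q; apply/andP; split; lra. Qed.

Let on_Gt_steps m (i : nat) : on_Gt m (2 * K * i)%N = odd_pt m.
Proof. by rewrite -on_Gt0 PoszM -[in LHS](add0r (_ * _)) on_Gt_time. Qed.

Variable n0 : 'rV[int]_d.
Hypothesis hn0 : odd_pt n0.

Lemma osc_contract_ge v v' (a : R) m : X v -> X v' ->
  (forall m, odd_pt m -> a <= v m - v' m) -> odd_pt m ->
  a + theta * (v n0 - v' n0 - a) <= T v m - T v' m.
Proof.
move=> Xv Xv' H modd.
have [] := @reach_in_exactly d N steps m n0 hN hd modd hn0.
- by rewrite /steps -!mulnA leq_mul2l leq_pmull.
- by rewrite /steps -mulnA oddM.
move=> p [a' [sp E]].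
have := @phi_diff_reach v v' a p m Xv H.
rewrite /= E sp -/steps => /(_ _).
have per w : X w -> w (n0 + \sum_j space_period N j *~ a' j) = w n0.
  move=> [Xp _]; apply: (@periodic_sum _ _ _ w 0) => [m' j|]; rewrite on_Gt0//.
  exact: Xp.
by rewrite !per//; apply; rewrite on_Gt_steps.
Qed.

(** The oscillation of a difference shrinks: its value at [n0] enters every
    value of the image with weight at least [theta]. *)
Lemma osc_contract v v' (a b : R) : X v -> X v' ->
  (forall m, odd_pt m -> a <= v m - v' m <= b) ->
  exists a' b', b' - a' = q * (b - a) /\
    forall m, odd_pt m -> a' <= T v m - T v' m <= b'.
Proof.
move=> Xv Xv' H.
exists (a + theta * (v n0 - v' n0 - a)), (b - theta * (b - (v n0 - v' n0))); split.
  by rewrite /q; ring.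
move=> m modd; apply/andP; split.
  by apply: osc_contract_ge => // m' /H/andP[].
have H' m' : odd_pt m' -> - b <= v' m' - v m' by move=> /H/andP[_]; lra.
have := osc_contract_ge Xv' Xv H' modd.
by generalize theta (T v m) (T v' m) => th t t'; lra.
Qed.

Lemma Xdelta_T v : X v -> X (T v).
Proof. exact: Xdelta_phi. Qed.

Lemma Xdelta_iterT v j : X v -> X (iter j T v).
Proof. by move=> Xv; elim: j => //= j; exact: Xdelta_T. Qed.

Lemma osc_contract_iter v v' : X v -> X v' ->
  exists C : R, forall j, exists a, forall m, odd_pt m ->
    a <= iter j T v m - iter j T v' m <= a + C * q ^+ j.
Proof.
move=> Xv Xv'.
have [||M HM] := @periodic_bounded d N R (fun m => v m - v' m) 0 => //.
  by move=> m j; rewrite on_Gt0 => modd; rewrite Xv.1// Xv'.1.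
exists (M + M); elim=> [|j [a IH]].
  exists (- M) => m; rewrite -on_Gt0 => /HM; rewrite ler_norml /= expr0 => /andP[? ?].
  by apply/andP; split; lra.
have [a' [b' [E H]]] := osc_contract (Xdelta_iterT j Xv) (Xdelta_iterT j Xv') IH.
exists a' => m /H; rewrite !iterS exprS.
suff -> : b' = a' + (M + M) * (q * q ^+ j) by [].
by rewrite -(subrK a' b') E addrC; congr (_ + _); ring.
Qed.

Lemma Xdelta_limit (u : nat -> 'rV[int]_d -> R) v (C : R) :
  (forall j, X (u j)) ->
  (forall m, odd_pt m -> forall j, `|v m - u j m| <= C * q ^+ j) -> X v.
Proof.
move=> Xu H; split=> [m j modd|m meven].
  have modd' : odd_pt (m + space_period N j) by rewrite -on_Gt0 on_Gt_space on_Gt0.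
  apply/eqP; rewrite -subr_eq0; apply/eqP.
  apply: (@geometric_eq0 _ _ (C + C) _ q01) => i.
  have := H _ modd i; have := H _ modd' i; rewrite (Xu i).1// mulrDl.
  by rewrite !ler_norml => /andP[? ?] /andP[? ?]; apply/andP; split; lra.
have nodd b : odd_pt (m + omega b).
  by rewrite -on_Gt0 on_Gt_omega /on_G addr0.
rewrite [leLHS]/Num.norm/= mx_normrE; apply/bigmax_leP; split=> [|[i j] _ /=].
  exact: ltW.
rewrite (ord1 i) -subr_le0.
have h0 : 0 < (2 * hstep R N)^-1 by rewrite invr_gt0 mulr_gt0 ?hstep_gt0.
apply: (@geometric_le0 _ _ ((C + C) * (2 * hstep R N)^-1) _ q01) => k.
have := le_trans (coord_le_norm _ j) ((Xu k).2 _ meven).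
rewrite !mxE -omega_true -omega_false.
have := H _ (nodd (j, false)) k; have := H _ (nodd (j, true)) k.
set A := v _; set B := v _; set A' := u k _; set B' := u k _ => h1 h2 h3.
rewrite lerBlDr.
have -> : (B - A) / (2 * hstep R N) = (B' - A') / (2 * hstep R N) +
   ((B - B') - (A - A')) / (2 * hstep R N) by ring.
rewrite (le_trans (ler_normD _ _))// addrC lerD//.
rewrite normrM (ger0_norm (ltW h0)) mulrAC ler_wpM2r ?(ltW h0)//.
by rewrite (le_trans (ler_normB _ _))// mulrDl lerD.
Qed.

(** The normalised iterates of [T] are Cauchy because [T] contracts
    oscillations; their limit is an eigenvector of [T]. *)
Lemma eigenvector_T : exists z kappa, X z /\
  forall m, odd_pt m -> T z m = z m + kappa.
Proof.
pose y j := iter j T (fun=> 0 : R).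
have Xy j : X (y j) by apply: Xdelta_iterT; exact: Xdelta0.
pose zz j m := y j m + (- y j n0).
have Xzz j : X (zz j) by apply: Xdelta_cst.
(* consecutive iterates are the iterates of the two data [T 0] and [0] *)
have [C HC] := @osc_contract_iter (T (fun=> 0)) (fun=> 0) (Xdelta_T Xdelta0) Xdelta0.
have inc m : odd_pt m -> forall j, `|zz j.+1 m - zz j m| <= C * q ^+ j.
  move=> modd j; have [a Ha] := HC j.
  move: (Ha _ modd) (Ha _ hn0); rewrite -!iterSr ler_norml /zz /y.
  by move=> /andP[? ?] /andP[? ?]; apply/andP; split; lra.
have lim m : exists l, odd_pt m -> forall j, `|l - zz j m| <= C / (1 - q) * q ^+ j.
  have [modd|] := boolP (odd_pt m); last by exists 0.
  by have [l Hl] := geometric_limit q01 (inc m modd); exists l.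
have [z Hz] := choice lim; set E := C / (1 - q) in Hz.
have Xz : X z := Xdelta_limit Xzz Hz.
have E0 : 0 <= E by have := le_trans (normr_ge0 _) (Hz _ hn0 0%N); rewrite expr0 mulr1.
exists z, (T z n0 - z n0); split=> // m modd.
apply/eqP; rewrite -subr_eq0; apply/eqP.
apply: (@geometric_eq0 _ _ (4 * E) _ q01) => j.
have step m' : odd_pt m' -> `|T z m' - (y j.+1 m' - y j n0)| <= E * q ^+ j.
  move=> m'odd.
  have -> : y j.+1 m' - y j n0 = T (zz j) m'.
    apply/esym; apply: (@phi_shift _ _ _ _ _ _ (zz j) (y j) (- y j n0)) => //.
    by rewrite on_Gt_steps.
  by apply: phi_dist_le => //; [move=> m'' modd''; exact: Hz|rewrite on_Gt_steps].
have s1 := step _ modd; have s2 := step _ hn0.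
have h1 := Hz _ modd j.+1; have h2 := Hz _ hn0 0%N.
have h3 := Hz _ hn0 j.+1.
have q0 : 0 <= q ^+ j by rewrite exprn_ge0//; case/andP: q01.
have Eq : E * q ^+ j.+1 <= E * q ^+ j.
  by rewrite ler_wpM2l// exprS ler_piMl//; case/andP: q01 => _ /ltW.
move: s1 s2 h1 h3; rewrite /zz !ler_norml.
move=> /andP[? ?] /andP[? ?] /andP[? ?] /andP[? ?]; rewrite -mulrA.
by apply/andP; split; lra.
Qed.

(** [phi _ (2 K)] commutes with its power [T], hence maps the eigenvector of [T]
    to another one; the two differ by a constant as [T] contracts oscillations. *)
Lemma effective_hamiltonian_exists : exists Hc, is_effective_hamiltonian N K L r c Hc.
Proof.
have [z [kappa [Xz Tz]]] := eigenvector_T.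
pose z' := phi z (2 * K).
have Xz' : X z' by exact: hstable.
have Tz' m : odd_pt m -> T z' m = z' m + kappa.
  move=> modd; rewrite /T /z'.
  transitivity (phi z (2 * K * 1 + steps) m).
    by rewrite phi_time// muln1.
  rewrite addnC muln1 /steps phi_time//.
  apply: phi_shift => //.
  by rewrite -[(2 * K)%N]muln1 on_Gt_steps.
have iterTz w (Hw : forall m, odd_pt m -> T w m = w m + kappa) j m : odd_pt m ->
    iter j T w m = w m + kappa *+ j.
  elim: j m => [|j IH] m modd; first by rewrite addr0.
  rewrite iterS mulrS addrA -Hw//.
  apply: phi_shift => //.
  by rewrite on_Gt_steps.
have [C HC] := osc_contract_iter Xz' Xz.
exists (z n0 - z' n0), z => // m modd; rewrite -/z'.
apply/eqP; rewrite -subr_eq0; apply/eqP; apply: (@geometric_eq0 _ _ C _ q01) => j.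
have [a Ha] := HC j; move: (Ha _ modd) (Ha _ hn0).
rewrite !iterTz// ler_norml => /andP[? ?] /andP[? ?].
by apply/andP; split; lra.
Qed.

End EffectiveHamiltonian.

(** * Random walks and dynamic programming *)

Section RandomWalk.
Variables (R : realType) (d N K : nat).
Implicit Types (m n : 'rV[int]_d).
Local Notation jp := (@jump_proba R d N K).

Lemma position0 n (p : seq (jump d)) : position n p 0 = n.
Proof. by rewrite /position take0 big_nil addr0. Qed.

Lemma position_cons n b (p : seq (jump d)) i :
  position n (b :: p) i.+1 = position (n + omega b) p i.
Proof. by rewrite /position /= big_cons addrA. Qed.

Lemma big_tuple_cons (T : finType) l (F : l.+1.-tuple T -> R) :
  \sum_p F p = \sum_b \sum_(p : l.-tuple T) F [tuple of b :: p].
Proof.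
rewrite pair_bigA/= (reindex (fun bp : T * l.-tuple T => [tuple of bp.1 :: bp.2]))//=.
exists (fun p => (thead p, [tuple of behead p])) => [[b p] _|p _] /=.
  by rewrite theadE; congr (_, _); apply/val_inj.
by rewrite -tuple_eta.
Qed.

(** The law of a walk whose velocities depend on the number of jumps made:
    [path_proba] with the time index turned into a step counter, so that the
    walk after its first jump is again of this form. *)
Definition path_weight (V : nat -> 'rV[int]_d -> 'rV[R]_d) n l (p : l.-tuple (jump d)) : R :=
  \prod_(i < l) jp (V i (position n p i)) (tnth p i).

Lemma path_weight_cons V n l b (p : l.-tuple (jump d)) :
  path_weight V n [tuple of b :: p] =
  jp (V 0%N n) b * path_weight (fun i => V i.+1) (n + omega b) p.
Proof.
rewrite /path_weight big_ord_recl position0; congr (_ * _).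
by apply: eq_bigr => i _; rewrite position_cons tnthS.
Qed.

Lemma on_Gt_jump (i : nat) m b : on_Gt m (- i%:Z) -> on_Gt (m + omega b) (- i.+1%:Z).
Proof. by rewrite on_Gt_omega -on_GtS -addn1 PoszD opprD subrK. Qed.

Lemma position_on_Gt n l (p : l.-tuple (jump d)) (i : nat) : odd_pt n -> (i <= l)%N ->
  on_Gt (position n p i) (- i%:Z).
Proof.
suff H j : (i <= l)%N -> on_Gt n (- j%:Z) -> on_Gt (position n p i) (- (j + i)%N%:Z).
  by move=> nodd il; apply: (H 0%N il); rewrite oppr0 on_Gt0.
elim: l p n i j => [|l IH] p n i j.
  by rewrite leqn0 => /eqP ->; rewrite position0 addn0.
case: i => [_|i il Dn]; first by rewrite position0 addn0.
rewrite (tuple_eta p) position_cons addnS -addSn; apply: (IH [tuple of behead p]) => //.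
exact: on_Gt_jump.
Qed.

End RandomWalk.

Section DynamicProgramming.
Variables (R : realType) (d N K : nat).
Implicit Types (m n : 'rV[int]_d).
Local Notation jp := (@jump_proba R d N K).

(** Iterating the one-step inequality along the walk: the first jump is split
    off, and the induction hypothesis applies to the walk that starts after it. *)
Lemma walk_iterate_le (D : nat -> 'rV[int]_d -> bool)
    (V : nat -> 'rV[int]_d -> 'rV[R]_d) (W C : nat -> 'rV[int]_d -> R) n l :
  (forall i m b, D i m -> D i.+1 (m + omega b)) ->
  (forall i m b, D i m -> 0 <= jp (V i m) b) ->
  (forall i m, D i m -> W i m <= C i m + \sum_b jp (V i m) b * W i.+1 (m + omega b)) ->
  (0 < d)%N -> D 0%N n ->
  W 0%N n <= \sum_(p : l.-tuple (jump d)) path_weight N K V n p *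
    (\sum_(i < l) C i (position n p i) + W l (position n p l)).
Proof.
move=> + + + d0.
elim: l n D V W C => [|l IH] n D V W C DS V0 step Dn.
  rewrite (big_pred1 [tuple]) => [|p]; last by apply/esym/eqP; exact: tuple0.
  by rewrite /path_weight !big_ord0 mul1r add0r position0.
apply: (le_trans (step _ _ Dn)).
rewrite big_tuple_cons.
have -> : C 0%N n = \sum_b jp (V 0%N n) b * C 0%N n.
  by rewrite -mulr_suml sum_jump_proba// mul1r.
rewrite -big_split/=; apply: ler_sum => b _; rewrite -mulrDr.
under eq_bigr => p _.
  rewrite path_weight_cons big_ord_recl/= !position0 position_cons.
  under eq_bigr do rewrite position_cons.
  rewrite -mulrA; over.
rewrite -mulr_sumr; apply: ler_wpM2l; first exact: V0.
set S := (X in _ <= X).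
(* the first cost is added to the terminal value of the shorter walk, which is
   harmless because its weights sum to 1 *)
have := IH (n + omega b) (fun i => D i.+1) (fun i => V i.+1)
  (fun i m => C 0%N n + W i.+1 m) (fun i => C i.+1) _ _ _ (DS _ _ _ Dn).
rewrite (_ : (\sum_p _) = S).
  apply=> [i m b'|i m b'|i m Dm]; [exact: DS|exact: V0|].
  under eq_bigr do rewrite mulrDr.
  rewrite big_split/= -mulr_suml sum_jump_proba// mul1r addrCA lerD2l.
  exact: step.
by apply: eq_bigr => p _; rewrite addrCA addrA.
Qed.

Lemma walk_iterate_eq (D : nat -> 'rV[int]_d -> bool)
    (V : nat -> 'rV[int]_d -> 'rV[R]_d) (W C : nat -> 'rV[int]_d -> R) n l :
  (forall i m b, D i m -> D i.+1 (m + omega b)) ->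
  (forall i m b, D i m -> 0 <= jp (V i m) b) ->
  (forall i m, D i m -> W i m = C i m + \sum_b jp (V i m) b * W i.+1 (m + omega b)) ->
  (0 < d)%N -> D 0%N n ->
  W 0%N n = \sum_(p : l.-tuple (jump d)) path_weight N K V n p *
    (\sum_(i < l) C i (position n p i) + W l (position n p l)).
Proof.
move=> DS V0 step d0 Dn; apply/eqP; rewrite eq_le; apply/andP; split.
  by apply: (walk_iterate_le _ DS V0) => // i m /step ->.
have := @walk_iterate_le D V (fun i m => - W i m) (fun i m => - C i m) n l DS V0 _ d0 Dn.
rewrite -[_ <= W _ _]lerN2 -sumrN => H.
apply: le_trans (H _) _ => [i m Dm|].
  by rewrite step// opprD lerD2l -sumrN; apply: ler_sum => b _; rewrite mulrN.
by apply: ler_sum => p _; rewrite -mulrN opprD sumrN.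
Qed.

End DynamicProgramming.

(** * Eternal solutions and verification *)

Section Phase.
Variables (d K : nat).
Hypothesis hK : (0 < K)%N.
Implicit Types (m : 'rV[int]_d) (k : int).

Let K2 : (2 * K)%:Z != 0. Proof. by lia. Qed.

Definition phase k : nat := `|(k %% (2 * K)%:Z)%Z|%N.

Lemma phase_lt k : (phase k < 2 * K)%N.
Proof.
have := ltz_pmod k (d := (2 * K)%:Z); have := modz_ge0 k K2.
by rewrite /phase; lia.
Qed.

Lemma phaseE k : k = (phase k)%:Z + (2 * K)%:Z * (k %/ (2 * K)%:Z)%Z.
Proof. by rewrite /phase gez0_abs ?modz_ge0// addrC mulrC; exact: divz_eq. Qed.

Lemma on_Gt_phase m k : on_Gt m k = on_Gt m (phase k).
Proof. by rewrite {1}(phaseE k) on_Gt_time. Qed.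

End Phase.

Section Verification.
Variables (R : realType) (d N K : nat).
Hypotheses (hd : (0 < d)%N) (hN : (0 < N)%N) (hK : (0 < K)%N).
Variable L : 'rV[R]_d * R * 'rV[R]_d -> R.
Hypothesis hL : lagrangian L.
Variables (r : R) (c : 'rV[R]_d) (Hc : R) (vbar : 'rV[int]_d -> R).
Hypothesis Xvbar : Xdelta N r vbar.
Hypothesis vbarE : forall m, odd_pt m -> phi N K L c vbar (2 * K) m + Hc = vbar m.
Implicit Types (m n : 'rV[int]_d) (k : int) (xi : int -> 'rV[int]_d -> 'rV[R]_d).
Local Notation jp := (@jump_proba R d N K).
Local Notation phi := (phi N K L c).
Local Notation tau := (tstep R K).
Local Notation phase := (phase K).

(** The solution with initial datum [vbar], extended to all times: over one
    period it changes by the constant [- Hc]. *)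
Definition eternal_solution k m : R := phi vbar (phase k) m - (k %/ (2 * K)%:Z)%Z%:~R * Hc.

Local Notation U := eternal_solution.

Lemma eternal_solution_at (q : int) (j : nat) m : (j <= 2 * K)%N -> on_Gt m j ->
  U (j%:Z + (2 * K)%:Z * q) m = phi vbar j m - q%:~R * Hc.
Proof.
have K2 : (2 * K)%:Z != 0 by lia.
rewrite leq_eqVlt => /orP[/eqP -> mk|jK _].
  have modd : odd_pt m by rewrite -on_Gt0 -(@on_Gt_time d K _ 0 1) mulr1 add0r.
  rewrite -[X in X + _]mulr1 -mulrDr mulrC /eternal_solution /phase modzMl mulzK//=.
  by rewrite -vbarE// rmorphD/=; ring.
rewrite addrC [(2 * K)%:Z * q]mulrC /eternal_solution /phase modzMDl divzMDl//.
rewrite modz_small; last by lia.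
by rewrite divz_small ?addr0//; lia.
Qed.

Lemma eternal_solution_step k m : on_G m k ->
  U (k + 1) m = scheme_step N K L c k (U k) m.
Proof.
move=> mk.
have jK : ((phase k).+1 <= 2 * K)%N by exact: phase_lt hK _.
have mj : on_Gt m (phase k).+1.
  by rewrite -addn1 PoszD -(@on_Gt_time d K _ _ (k %/ (2 * K)%:Z)%Z) addrAC -(phaseE hK) on_GtS.
rewrite {1}(phaseE hK k) -addrAC -PoszD addn1 eternal_solution_at// phiS.
transitivity (scheme_step N K L c (phase k) (U k) m); last first.
  by rewrite {3}(phaseE hK k) scheme_step_time.
by apply/esym; exact: scheme_step_shift.
Qed.

Lemma optimal_velocity_eternal k m :
  optimal_velocity N K L c k (U k) m =
  optimal_velocity N K L c (phase k) (phi vbar (phase k)) m.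
Proof.
rewrite /optimal_velocity {1}(phaseE hK k) tpt_time//.
rewrite (@Dx_shift _ _ _ (U k) (phi vbar (phase k)) m m (- ((k %/ (2 * K)%:Z)%Z%:~R * Hc)))//.
by rewrite /hamiltonian_p hamiltonian_time.
Qed.

(** [vbar] loses [Hc] per period, that is at rate [Hc] in time; the phase contributes
    at most one period. *)
Lemma eternal_solution_bounded : exists M : R, forall (l : nat) m, on_Gt m (- l%:Z) ->
  `|U (- l%:Z) m - tpt R K l * Hc| <= M.
Proof.
have bounded (j : nat) : exists b : R, forall m, on_Gt m j -> `|phi vbar j m| <= b.
  apply: (periodic_bounded hN) => m i mj; apply: phi_space => //.
  exact: Xvbar.1.
have [b Hb] := choice bounded.
exists (\sum_(j < 2 * K) `|b j| + `|Hc|) => l m ml.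
set k := - l%:Z in ml *.
have mj : on_Gt m (phase k) by rewrite -(on_Gt_phase hK).
have E : U k m - tpt R K l * Hc = phi vbar (phase k) m + tau * (phase k)%:R * Hc.
  rewrite /eternal_solution -addrA; congr (_ + _).
  have tauK : tau * (2 * K)%:R = 1 by rewrite /tstep mulVf// pnatr_eq0; lia.
  rewrite -opprD -mulrDl -mulNr; congr (_ * _).
  have := congr1 (fun z : int => tau * z%:~R) (phaseE hK k).
  rewrite /k rmorphN/= rmorphD/= rmorphM/= mulrDr mulrA -!pmulrn tauK mul1r /tpt.
  by rewrite -/k -!pmulrn; lra.
rewrite E (le_trans (ler_normD _ _))// lerD//.
  apply: le_trans (Hb _ _ mj) _; rewrite (bigD1 (Ordinal (phase_lt hK k)))//=.
  rewrite (le_trans (ler_norm _))// lerDl; exact: sumr_ge0.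
rewrite normrM ler_piMl// ger0_norm; last by rewrite mulr_ge0// ltW// tstep_gt0.
rewrite /tstep mulrC ler_pdivrMr ?ltr0n; last by lia.
by rewrite mul1r ler_nat ltnW// (phase_lt hK).
Qed.

(** The velocity at time [k] governs the jump from time [k] back to [k - 1], hence the
    step of the scheme from [k - 1] to [k]. *)
Definition optimal_control k m : 'rV[R]_d :=
  optimal_velocity N K L c (phase (k - 1)) (phi vbar (phase (k - 1))) m.

(** The cost is taken one time step earlier than the velocity: a step of the scheme
    from [t_{k-1}] to [t_k] uses the Lagrangian at [t_{k-1}]. *)
Definition mean_action xi n l : R := walk_expectation N K xi n (fun p : l.-tuple (jump d) =>
  (tpt R K l)^-1 * \sum_(i < l) lagrangian_c L c (xpt R N (position n p i))
    (tpt R K (- i%:Z) - tau) (xi (- i%:Z) (position n p i)) * tau).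

Lemma admissible_jump_ge0 xi k m b : admissible N K xi -> on_Gt m k -> 0 <= jp (xi k m) b.
Proof.
move=> adm mk; have [xiA _ _] := adm _ _ mk.
have lam0 := @mesh_ratio_gt0 R N K hN hK.
apply: le_trans (jump_proba_ge b (ltW lam0) xiA).
have d0 : d%:R != 0 :> R by rewrite pnatr_eq0 -lt0n.
rewrite natrM (_ : _ - _ = 0)//; field; rewrite d0 /= .
by rewrite gt_eqF.
Qed.

Lemma tptB1 k : tpt R K (k - 1) = tpt R K k - tau.
Proof. by rewrite /tpt rmorphB/= mulrBr mulr1. Qed.

Let on_G_pred (i : nat) m : on_Gt m (- i%:Z) -> on_G m (- i%:Z - 1).
Proof. by rewrite -on_GtS subrK. Qed.

Let step_cost xi (i : nat) m : R :=
  lagrangian_c L c (xpt R N m) (tpt R K (- i%:Z) - tau) (xi (- i%:Z) m) * tau.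

Lemma eternal_step_le xi (i : nat) m : on_Gt m (- i%:Z) ->
  U (- i%:Z) m <= step_cost xi i m + \sum_b jp (xi (- i%:Z) m) b * U (- i.+1%:Z) (m + omega b).
Proof.
move=> mi; have E : - i.+1%:Z = - i%:Z - 1 by rewrite -addn1 PoszD opprD.
rewrite -{1}(subrK 1 (- i%:Z)) eternal_solution_step; last exact: on_G_pred.
rewrite /step_cost -tptB1 E mulrC; apply: scheme_step_le => //.
exact/ltW/tstep_gt0.
Qed.

Lemma eternal_step_eq (i : nat) m : on_Gt m (- i%:Z) ->
  U (- i%:Z) m = step_cost optimal_control i m +
    \sum_b jp (optimal_control (- i%:Z) m) b * U (- i.+1%:Z) (m + omega b).
Proof.
move=> mi; have E : - i.+1%:Z = - i%:Z - 1 by rewrite -addn1 PoszD opprD.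
rewrite -{1}(subrK 1 (- i%:Z)) eternal_solution_step; last exact: on_G_pred.
by rewrite (scheme_step_eq N K hL) /step_cost -tptB1 E optimal_velocity_eternal mulrC.
Qed.

Lemma path_proba_ge0 xi n l (p : l.-tuple (jump d)) : admissible N K xi -> odd_pt n ->
  0 <= path_proba N K xi n p.
Proof.
move=> adm nodd; apply: prodr_ge0 => i _; apply: admissible_jump_ge0 => //.
by apply: position_on_Gt => //; exact: ltnW.
Qed.

Lemma sum_path_proba xi n l : admissible N K xi -> odd_pt n ->
  \sum_(p : l.-tuple (jump d)) path_proba N K xi n p = 1.
Proof.
move=> adm nodd.
have := @walk_iterate_eq R d N K (fun i m => on_Gt m (- i%:Z)) (fun i => xi (- i%:Z))
  (fun _ _ => 1) (fun _ _ => 0) n l (@on_Gt_jump d)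
  (fun i m b mi => admissible_jump_ge0 b adm mi) _ hd.
rewrite oppr0 on_Gt0 => -> //; last first.
  by move=> i m _; rewrite -mulr_suml mulr1 add0r sum_jump_proba.
by apply: eq_bigr => p _; rewrite big1// add0r mulr1.
Qed.

Let mean_actionE xi n l : (0 < l)%N ->
  tpt R K l * mean_action xi n l =
  \sum_(p : l.-tuple (jump d)) path_proba N K xi n p * \sum_(i < l) step_cost xi i (position n p i).
Proof.
move=> l0; rewrite /mean_action /walk_expectation mulr_sumr; apply: eq_bigr => p _.
by rewrite mulrCA mulVKf// gt_eqF// tpt_gt0.
Qed.

(** Averaging [eternal_solution_bounded] over the end point of the walk. *)
Lemma terminal_mean_le xi n l M : admissible N K xi -> odd_pt n ->
  (forall (l : nat) m, on_Gt m (- l%:Z) -> `|U (- l%:Z) m - tpt R K l * Hc| <= M) ->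
  `|\sum_(p : l.-tuple (jump d)) path_proba N K xi n p * U (- l%:Z) (position n p l)
    - tpt R K l * Hc| <= M.
Proof.
move=> adm nodd HM.
rewrite -[tpt R K l * Hc]mul1r -(sum_path_proba l adm nodd) mulr_suml -sumrB.
rewrite (le_trans (ler_norm_sum _ _ _))// -[leRHS]mul1r -(sum_path_proba l adm nodd) mulr_suml.
apply: ler_sum => p _; rewrite -mulrBr normrM ger0_norm ?path_proba_ge0//.
rewrite ler_wpM2l ?path_proba_ge0//; apply: HM.
exact: position_on_Gt.
Qed.

(** Both boundary terms of the iterated inequality are known up to a bounded error:
    the value at time 0, and [tpt R K l * Hc] at the end of the walk. *)
Lemma mean_action_ge n : odd_pt n -> exists M : R, forall xi l, admissible N K xi -> (0 < l)%N ->
  - Hc - M / tpt R K l <= mean_action xi n l.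
Proof.
move=> nodd; have [M HM] := eternal_solution_bounded.
exists (M + M) => xi l adm l0; have tl := tpt_gt0 R hK l0.
rewrite -(ler_pM2l tl) mulrBr [X in _ - X]mulrC divfK ?gt_eqF//.
have := @walk_iterate_le R d N K (fun i m => on_Gt m (- i%:Z)) (fun i => xi (- i%:Z))
  (fun i => U (- i%:Z)) (step_cost xi) n l (@on_Gt_jump d)
  (fun i m b mi => admissible_jump_ge0 b adm mi) (eternal_step_le xi) hd.
rewrite oppr0 on_Gt0 => /(_ nodd).
under eq_bigr do rewrite mulrDr.
rewrite big_split/= -mean_actionE// => H.
have := terminal_mean_le l adm nodd HM; rewrite ler_norml => /andP[_].
have := HM 0%N n; rewrite oppr0 on_Gt0 => /(_ nodd).
rewrite /tpt mulr0 mul0r subr0 ler_norml => /andP[+ _].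
move: H; rewrite /path_weight /path_proba /tpt; lra.
Qed.

(** The optimal control makes every one-step inequality an equality. *)
Lemma mean_action_optimal_le n : odd_pt n -> admissible N K optimal_control ->
  exists M : R, forall l, (0 < l)%N -> mean_action optimal_control n l <= - Hc + M / tpt R K l.
Proof.
move=> nodd adm; have [M HM] := eternal_solution_bounded.
exists (M + M) => l l0; have tl := tpt_gt0 R hK l0.
rewrite -(ler_pM2l tl) mulrDr [X in _ + X]mulrC divfK ?gt_eqF//.
have := @walk_iterate_eq R d N K (fun i m => on_Gt m (- i%:Z)) (fun i => optimal_control (- i%:Z))
  (fun i => U (- i%:Z)) (step_cost optimal_control) n l (@on_Gt_jump d)
  (fun i m b mi => admissible_jump_ge0 b adm mi) eternal_step_eq hd.
rewrite oppr0 on_Gt0 => /(_ nodd).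
under eq_bigr do rewrite mulrDr.
rewrite big_split/= -mean_actionE// => H.
have := terminal_mean_le l adm nodd HM; rewrite ler_norml => /andP[+ _].
have := HM 0%N n; rewrite oppr0 on_Gt0 => /(_ nodd).
rewrite /tpt mulr0 mul0r subr0 ler_norml => /andP[_].
move: H; rewrite /path_weight /path_proba /tpt; lra.
Qed.

Lemma optimal_control_admissible (lambda1 : R) : mesh_ratio R N K <= lambda1 ->
  (forall (k : nat) m, on_G m k ->
    `|optimal_velocity N K L c k (phi vbar k) m| <= (d%:R * lambda1)^-1) ->
  admissible N K optimal_control.
Proof.
move=> lam1 CFL k m mk.
have d0 : 0 < d%:R :> R by rewrite ltr0n.
have lam0 := @mesh_ratio_gt0 R N K hN hK.
have mj : on_G m (phase (k - 1)).
  by rewrite on_GE -(on_Gt_phase hK) -on_GE -on_GtS subrK.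
split.
- apply: le_trans (CFL _ _ mj) _; rewrite lef_pV2 ?posrE.
  + by rewrite ler_wpM2l.
  + exact: mulr_gt0 (lt_le_trans lam0 lam1).
  + exact: mulr_gt0.
- by rewrite /optimal_control addrAC /phase modzDr.
move=> j; rewrite /optimal_control /optimal_velocity.
have -> : Dx N (phi vbar (phase (k - 1))) (m + space_period N j) =
    Dx N (phi vbar (phase (k - 1))) m.
  apply: (@Dx_shift _ _ _ _ _ _ _ 0) => b.
  rewrite addr0 addrAC; apply: phi_space => //; first exact: Xvbar.1.
  by rewrite on_Gt_omega.
move: (c + _) (tpt _ _ _) => p t.
by apply/rowP => i; rewrite !mxE (hamiltonian_space hN hL m j t).
Qed.

End Verification.

(** * Finitely supported probability measures *)

Section DiscreteMeasures.
Context d (T : measurableType d) (R : realType).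
Variables (w : nat -> {nonneg R}) (z : nat -> T) (n : nat).
Hypothesis sum_w : \sum_(i < n) (w i)%:num = 1.

Definition discrete_measure : set T -> \bar R :=
  msum (fun i => mscale (w i) (dirac (z i))) n.

HB.instance Definition _ := Measure.on discrete_measure.

Let discrete_measureT : discrete_measure setT = 1%E.
Proof.
transitivity ((\sum_(i < n) (w i)%:num)%:E); last by rewrite sum_w.
rewrite /discrete_measure /msum -sumEFin; apply: eq_bigr => i _.
change ((w i)%:num%:E * (\1_[set: T] (z i))%:E = (w i)%:num%:E :> \bar R)%E.
by rewrite indicT mule1.
Qed.

HB.instance Definition _ :=
  Measure_isProbability.Build _ _ _ discrete_measure discrete_measureT.

Let ge0_integral_discrete (f : T -> R) : measurable_fun setT f -> (forall x, 0 <= f x) ->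
  (\int[discrete_measure]_x (f x)%:E)%E = (\sum_(i < n) (w i)%:num * f (z i))%:E.
Proof.
move=> mf f0.
have mEf : measurable_fun setT (fun x : T => (f x)%:E : \bar R).
  exact/measurable_EFinP.
rewrite ge0_integral_measure_sum// -?sumEFin; last by move=> x _; rewrite lee_fin.
apply: eq_bigr => i _; rewrite ge0_integral_mscale//; last by move=> x _; rewrite lee_fin.
by rewrite integral_dirac// diracT mul1e EFinM.
Qed.

Lemma integral_discrete (f : T -> R) : measurable_fun setT f ->
  (\int[discrete_measure]_x (f x)%:E)%E = (\sum_(i < n) (w i)%:num * f (z i))%:E.
Proof.
move=> mf; rewrite integralE.
have -> : (fun x => (f x)%:E)^\+%E = EFin \o (fun x => Num.max (f x) 0).
  by apply/funext => x; rewrite funeposE /= EFin_max.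
have -> : (fun x => (f x)%:E)^\-%E = EFin \o (fun x => Num.max (- f x) 0).
  by apply/funext => x; rewrite funenegE /= EFin_max.
rewrite !ge0_integral_discrete; first last.
- by move=> x; rewrite le_max lexx orbT.
- exact: measurable_funrpos mf.
- by move=> x; rewrite le_max lexx orbT.
- exact: measurable_funrneg mf.
rewrite -EFinB -sumrB; congr EFin; apply: eq_bigr => i _.
rewrite -mulrBr; congr (_ * _); rewrite !maxEle.
by case: ifP; case: ifP; lra.
Qed.

Definition discrete_probability : probability T R := discrete_measure.

End DiscreteMeasures.

(** Measures indexed by the type of atoms rather than by an initial segment of the
    integers. *)
Lemma finite_probability_exists d (T : measurableType d) (R : realType) (S : finType)
    (w : S -> R) (z : S -> T) : (forall s, 0 <= w s) -> \sum_s w s = 1 ->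
  exists mu : probability T R, forall f : T -> R, measurable_fun setT f ->
    (\int[mu]_x (f x)%:E)%E = (\sum_s w s * f (z s))%:E.
Proof.
move=> w0 w1.
have [s0 _|S0] := pickP (fun _ : S => true); last first.
  by move: w1; rewrite big_pred0// => /eqP; rewrite eq_sym oner_eq0.
pose s (i : nat) := nth s0 (enum S) i.
have sumE (F : S -> R) : \sum_(i < #|S|) F (s i) = \sum_s F s.
  by rewrite -[RHS]big_enum (big_nth s0) big_mkord -cardE.
have w1' : \sum_(i < #|S|) (NngNum (w0 (s i)))%:num = 1 by rewrite /= sumE.
exists (@discrete_probability _ T R (fun i => NngNum (w0 (s i))) (fun i => z (s i)) _ w1') => f mf.
by rewrite integral_discrete//= (sumE (fun s => w s * f (z s))).
Qed.

(** * Topology of the state space *)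

Section TorusTopology.
Local Open Scope quotient_scope.

(** The projection onto a quotient by a subgroup is open, as the saturation of an
    open set is a union of its translates. *)
Lemma nbhs_pi (R : realType) (V : normedModType R) (Q : quotType V) (x : V) (A : set V) :
  (forall a b u : V, \pi_(quotient_topology Q) a = \pi_(quotient_topology Q) b ->
    \pi_(quotient_topology Q) (u + (a - b)) = \pi_(quotient_topology Q) u) ->
  nbhs x A -> nbhs (\pi_(quotient_topology Q) x) (\pi_(quotient_topology Q) @` A).
Proof.
move=> inv; rewrite nbhsE => -[U [oU Ux] UA].
rewrite nbhsE; exists (\pi_(quotient_topology Q) @` U); last exact: image_subset.
split; last by exists x.
rewrite /open/= /quotient_open openE => y [u Uu uy]; rewrite /interior.
have c : {for y, continuous (fun y' => y' + (u - y))}.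
  apply: (@continuousD _ _ _ id (cst (u - y))); first exact: cvg_id.
  exact: cvg_cst.
have : nbhs (y + (u - y)) U by rewrite addrC subrK; exact: open_nbhs_nbhs.
move=> h; have h' : nbhs y ((fun y' => y' + (u - y)) @^-1` U) := c _ h.
apply: (@filterS _ (nbhs y) _ _ _ _ h') => y' Uy'; exists (y' + (u - y)) => //.
exact: (inv u y y' uy).
Qed.

Variables (R : realType) (d : nat).

Lemma nbhs_to_torus (x : 'rV[R]_d) (A : set 'rV[R]_d) :
  nbhs x A -> nbhs (to_torus x) (@to_torus R d @` A).
Proof.
apply: nbhs_pi => a b u /to_torusP ab; apply/to_torusP.
by rewrite addrAC subrr add0r.
Qed.

Lemma nbhs_to_circle (t : R) (A : set R) :
  nbhs t A -> nbhs (to_circle t) (@to_circle R @` A).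
Proof.
apply: nbhs_pi => a b u /to_circleP ab; apply/to_circleP.
by rewrite addrAC subrr add0r.
Qed.

Lemma to_torus_repr (q : torus R d) : to_torus (repr q) = q.
Proof. exact: reprK. Qed.

Lemma to_circle_repr (q : circle R) : to_circle (repr q) = q.
Proof. exact: reprK. Qed.

(** The two projections and the identity of the velocity space are open maps, hence
    so is their product, through which the periodic function [g] factors. *)
Lemma state_fun_continuous (g : 'rV[R]_d * R * 'rV[R]_d -> R) :
  continuous g ->
  (forall x x' t t' zeta, to_torus x = to_torus x' -> to_circle t = to_circle t' ->
    g (x, t, zeta) = g (x', t', zeta)) ->
  continuous (fun z : state R d => g (repr z.1.1, repr z.1.2, z.2)).
Proof.
move=> cg inv [[a b] zeta] V /= /cg [[W12 W3] /= [[[W1 W2] /= [h1 h2] h12] h3] hW].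
exists ((@to_torus R d @` W1) `*` (@to_circle R @` W2), W3) => /=.
  split=> //; exists (@to_torus R d @` W1, @to_circle R @` W2) => //=; split.
    by rewrite -(to_torus_repr a); exact: nbhs_to_torus.
  by rewrite -(to_circle_repr b); exact: nbhs_to_circle.
move=> [[a' b'] zeta'] /= [[[x W1x xa'] [t W2t tb']] W3z] /=.
rewrite (inv _ x _ t); first by apply: hW; split=> //; exact: h12.
  by rewrite to_torus_repr.
by rewrite to_circle_repr.
Qed.

(** Subtracting the integer parts brings every point into the unit ball. *)
Lemma torus_compact : compact [set: torus R d].
Proof.
rewrite (_ : [set: _] = @to_torus R d @` [set v | `|v| <= 1]).
  apply: continuous_compact (@compact_norm_le R d 1).
  by apply: continuous_subspaceT; exact: pi_continuous.
apply/seteqP; split=> // q _; pose x := repr q.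
exists (\row_j (x 0 j - (Num.floor (x 0 j))%:~R)); last first.
  rewrite -(to_torus_repr q) -/x; apply/to_torusP; apply/mxOverP => i j.
  rewrite (ord1 i) !mxE addrAC subrr add0r -rmorphN/=; exact: intr_int.
rewrite /= [leLHS]/Num.norm/= mx_normrE; apply/bigmax_leP; split=> // -[i j] _ /=.
rewrite mxE; have := floor_itv (x 0 j) => /andP[].
rewrite rmorphD/= => ? ?; rewrite ger0_norm; lra.
Qed.

Lemma circle_compact : compact [set: circle R].
Proof.
rewrite (_ : [set: _] = @to_circle R @` `[0, 1]).
  apply: continuous_compact (@segment_compact R 0 1).
  by apply: continuous_subspaceT; exact: pi_continuous.
apply/seteqP; split=> // q _; pose t := repr q.
exists (t - (Num.floor t)%:~R); last first.
  rewrite -(to_circle_repr q) -/t; apply/to_circleP.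
  by rewrite addrAC subrr add0r -rmorphN/=; exact: intr_int.
rewrite /= in_itv /=; have := floor_itv t => /andP[].
by rewrite rmorphD/= => ? ?; apply/andP; split; lra.
Qed.

Lemma velocity_continuous : continuous (fun z : state R d => z.2).
Proof. by move=> z; exact: cvg_snd. Qed.

Lemma compact_velocity_le (B : R) : @compact (state R d) [set z | `|z.2| <= B].
Proof.
rewrite (_ : [set z | _] = ([set: torus R d] `*` [set: circle R]) `*` [set v | `|v| <= B]).
  apply: compact_setX; last exact: compact_norm_le.
  by apply: compact_setX; [exact: torus_compact|exact: circle_compact].
by apply/seteqP; split=> [[[a b] v] ?|[[a b] v] [_ ?]].
Qed.

Lemma closed_velocity_le (B : R) : @closed (state R d) [set z | `|z.2| <= B].
Proof.
apply: (@closed_comp _ _ (fun z : state R d => z.2) [set v | `|v| <= B]).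
  by move=> z _; exact: velocity_continuous.
exact: closed_norm_le.
Qed.

Lemma compactly_supported_velocity (B : R) (f : state R d -> R) :
  (forall z, B < `|z.2| -> f z = 0) -> compactly_supported f.
Proof.
move=> fB; apply: (subclosed_compact _ (@compact_velocity_le B)).
  exact: closed_closure.
rewrite [X in _ `<=` X](closure_id _).1; last exact: closed_velocity_le.
apply: closure_subset => z /= fz; rewrite leNgt; apply/negP => zB.
by move: fz; rewrite fB// eqxx.
Qed.

Lemma bounded_velocity (B : R) (f : state R d -> R) : continuous f ->
  (forall z, B < `|z.2| -> f z = 0) -> exists M : R, forall z, `|f z| <= M.
Proof.
move=> cf fB.
have /compact_bounded/ex_strict_bound_gt0[M M0 /= HM] :
    compact (f @` ([set z | `|z.2| <= B] : set (state R d))).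
  by apply: continuous_compact (@compact_velocity_le B); exact: continuous_subspaceT.
exists M => z; have [zB|/fB ->] := leP `|z.2| B; last by rewrite normr0 ltW.
by apply: ltW; apply: HM; exists z.
Qed.

Lemma continuous_borel_measurable (f : state R d -> R) : continuous f ->
  measurable_fun [set: borel_state R d] (f : borel_state R d -> R).
Proof.
move=> /continuousP cf; apply: (measurability _ (RGenOpens.measurableE R)).
move=> _ [_ [a [b ->] <-]]; rewrite setTI; apply: sub_sigma_algebra.
exact/cf/interval_open.
Qed.

End TorusTopology.

(** * Occupation of the states by a walk *)

Section WalkMeasures.
Variables (R : realType) (d N K : nat).
Hypotheses (hd : (0 < d)%N) (hN : (0 < N)%N) (hK : (0 < K)%N).
Implicit Types (m n : 'rV[int]_d) (k : int) (xi : int -> 'rV[int]_d -> 'rV[R]_d).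
Local Notation tau := (tstep R K).

(** Time averages of functions of the index of the walk, to which averages of
    functions on the state space reduce. *)
Definition index_average (g : int -> 'rV[int]_d -> R) n l (p : l.-tuple (jump d)) : R :=
  (tpt R K l)^-1 * \sum_(i < l) g (- i%:Z) (position n p i) * tau.

Lemma index_average_ext (g g' : int -> 'rV[int]_d -> R) n l (p : l.-tuple (jump d)) :
  odd_pt n -> (forall k m, on_Gt m k -> g k m = g' k m) ->
  index_average g n p = index_average g' n p.
Proof.
move=> nodd gg'; congr (_ * _); apply: eq_bigr => i _; rewrite gg'//.
by apply: position_on_Gt => //; exact: ltnW.
Qed.

Lemma index_average_cst (a : R) n l (p : l.-tuple (jump d)) : (0 < l)%N ->
  index_average (fun _ _ => a) n p = a.
Proof.
move=> l0; rewrite /index_average sumr_const card_ord -mulr_natl.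
have := gt_eqF (tpt_gt0 R hK l0); rewrite /tpt -pmulrn => t0.
by rewrite [_ * (a * _)]mulrCA [_%:R * _]mulrC mulrCA mulVf ?t0// mulr1.
Qed.

Lemma index_average_sum (I : finType) (g : I -> int -> 'rV[int]_d -> R) (a : I -> R) n l
    (p : l.-tuple (jump d)) :
  \sum_s index_average (g s) n p * a s = index_average (fun k m => \sum_s g s k m * a s) n p.
Proof.
rewrite /index_average; under eq_bigr do rewrite -mulrA mulr_suml.
rewrite -mulr_sumr exchange_big/=; congr (_ * _); apply: eq_bigr => i _.
by rewrite mulr_suml; apply: eq_bigr => s _; rewrite mulrAC.
Qed.

Lemma periodic_time (T : Type) (u : int -> T) (A : int -> bool) k :
  (forall k (q : int), A (k + (2 * K)%:Z * q) = A k) ->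
  (forall k, A k -> u (k + (2 * K)%:Z) = u k) -> A k ->
  forall q : int, u (k + (2 * K)%:Z * q) = u k.
Proof.
move=> AK up Ak; elim/int_rec => [|q IH|q IH]; first by rewrite mulr0 addr0.
  by rewrite intS addrC mulrDr mulr1 -addrA [_ * _ + k]addrC addrC up ?AK.
rewrite -(up (k + _)) ?AK// -IH; congr u; rewrite intS; ring.
Qed.

End WalkMeasures.

Section StateCycle.
Variables (R : realType) (d N K : nat).
Hypotheses (hd : (0 < d)%N) (hN : (0 < N)%N) (hK : (0 < K)%N).
Variable xi : int -> 'rV[int]_d -> 'rV[R]_d.
Hypothesis adm : admissible N K xi.
Implicit Types (m n : 'rV[int]_d) (k : int).
Local Notation tau := (tstep R K).

(** A walk with a periodic control only visits finitely many states. *)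
Definition cell : finType := ({ffun 'I_d -> 'I_(2 * N).-1.+1} * 'I_(2 * K))%type.

Definition cell_of k m : cell := (reduce_index N m, Ordinal (phase_lt hK k)).

Definition walk_state k m : state R d :=
  (to_torus (xpt R N m), to_circle (tpt R K k), xi k m).

Definition cell_state (s : cell) : state R d := walk_state (s.2 : nat)%:Z (lift_index s.1).

Lemma to_torus_xpt_space m j : to_torus (xpt R N (m + space_period N j)) = to_torus (xpt R N m).
Proof.
apply/to_torusP; rewrite xpt_space// addrAC subrr add0r; apply/mxOverP => i i'.
by rewrite mxE; case: (_ && _); rewrite ?rpred1 ?rpred0.
Qed.

Lemma walk_stateE k m : on_Gt m k -> walk_state k m = cell_state (cell_of k m).
Proof.
move=> mk; rewrite /cell_state /cell_of /=.
set m' := lift_index (reduce_index N m).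
have mk' : on_Gt m' k by have [] := @periodic_reduce d N _ (fun _ => tt) k m hN _ mk.
have -> : walk_state (phase K k) m' = walk_state k m'.
  rewrite {2}(phaseE hK k) /walk_state tpt_time//; congr (_, _, _).
    apply/to_circleP; rewrite opprD addrA subrr add0r -rmorphN/=; exact: intr_int.
  apply/esym.
  apply: (@periodic_time K _ (fun k => xi k m') (fun k => on_Gt m' k) (phase K k)).
  - by move=> k' q; rewrite on_Gt_time.
  - by move=> k' mk''; have [_ -> _] := adm mk''.
  - by rewrite -(on_Gt_phase hK).
have per m'' j : on_Gt m'' k -> walk_state k (m'' + space_period N j) = walk_state k m''.
  by move=> mk''; have [_ _ xiE] := adm mk''; rewrite /walk_state to_torus_xpt_space xiE.
by have [_ ->] := periodic_reduce hN per mk.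
Qed.

Variable n : 'rV[int]_d.
Hypothesis nodd : odd_pt n.

Definition occupation l (s : cell) : R := walk_expectation N K xi n
  (fun p : l.-tuple (jump d) => index_average K (fun k m => (cell_of k m == s)%:R) n p).

Lemma occupation_ge0 l s : (0 < l)%N -> 0 <= occupation l s.
Proof.
move=> l0; apply: sumr_ge0 => p _; apply: mulr_ge0; first exact: path_proba_ge0.
apply: mulr_ge0; first by rewrite invr_ge0 ltW// tpt_gt0.
by apply: sumr_ge0 => i _; apply: mulr_ge0 => //; rewrite ltW// tstep_gt0.
Qed.

Lemma occupation_sum l (a : cell -> R) :
  \sum_s occupation l s * a s = walk_expectation N K xi n
    (fun p : l.-tuple (jump d) => index_average K (fun k m => a (cell_of k m)) n p).
Proof.
rewrite /occupation /walk_expectation.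
under eq_bigr do rewrite mulr_suml.
rewrite exchange_big/=; apply: eq_bigr => p _.
under eq_bigr do rewrite -mulrA.
rewrite -mulr_sumr index_average_sum; congr (_ * _).
apply: index_average_ext => // k m _.
rewrite (bigD1 (cell_of k m))//= eqxx mul1r big1 ?addr0// => s /negbTE sn.
by rewrite eq_sym sn mul0r.
Qed.

Lemma occupation_sum1 l : (0 < l)%N -> \sum_s occupation l s = 1.
Proof.
move=> l0; have := occupation_sum l (fun=> 1); under eq_bigr do rewrite mulr1.
move=> ->; rewrite -[RHS](sum_path_proba hd hN hK l adm nodd); apply: eq_bigr => p _.
by rewrite index_average_cst// mulr1.
Qed.

Lemma occupation_le1 l s : (0 < l)%N -> occupation l s <= 1.
Proof.
move=> l0; rewrite -(occupation_sum1 l0) (bigD1 s)//= lerDl.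
by apply: sumr_ge0 => s' _; exact: occupation_ge0.
Qed.

Lemma walk_measureP l (mu : probability (borel_state R d) R) : (0 < l)%N ->
  (forall f : state R d -> R, measurable_fun [set: borel_state R d] (f : borel_state R d -> R) ->
    (\int[mu]_z (f z)%:E)%E = (\sum_s occupation l s * f (cell_state s))%:E) ->
  is_walk_measure N K xi n l mu.
Proof.
move=> l0 H f cf _; rewrite H; last exact: continuous_borel_measurable.
congr EFin; rewrite occupation_sum; apply: eq_bigr => p _; congr (_ * _).
rewrite -[RHS]/(index_average K (fun k m => f (walk_state k m)) n p).
by apply: index_average_ext => // k m mk; rewrite walk_stateE.
Qed.

End StateCycle.

(** * Subsequences *)

Section Subsequences.

Lemma increasing_seq_ge (f : nat -> nat) i : {homo f : i j / (i < j)%N} -> (i <= f i)%N.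
Proof. by move=> finc; elim: i => // i IH; apply: leq_ltn_trans IH (finc _ _ _). Qed.

Lemma increasing_seq_cvg (f : nat -> nat) : {homo f : i j / (i < j)%N} -> f @ \oo --> \oo.
Proof.
move=> finc A [n _ nA]; exists n => // i /= ni; apply: nA => /=.
exact: leq_trans ni (increasing_seq_ge _ finc).
Qed.

(** A subsequence is extracted for each index in turn. *)
Lemma bolzano_weierstrass_finite (R : realType) (S : finType) (w : nat -> S -> R) :
  (forall i s, `|w i s| <= 1) -> exists2 f : nat -> nat, {homo f : i j / (i < j)%N} &
    forall s, cvgn (fun i => w (f i) s).
Proof.
move=> w1; suff H (r : seq S) : exists2 f : nat -> nat, {homo f : i j / (i < j)%N} &
    forall s, s \in r -> cvgn (fun i => w (f i) s).
  by have [f finc Hf] := H (enum S); exists f => // s; apply: Hf; rewrite mem_enum.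
elim: r => [|s r [f finc Hf]]; first by exists id.
have [|g ginc Hg] := @bolzano_weierstrass R (fun i => w (f i) s).
  by exists 1; split=> // M M1 i _; rewrite /= (le_trans (w1 _ _))// ltW.
have ginc' : {homo g : i j / (i < j)%N}.
  by move=> i j ij; rewrite !ltnNge; apply: contraTN ij; rewrite -leqNgt => gij;
     rewrite -(ginc j i).
exists (f \o g) => [i j ij|s']; first by apply: finc; exact: ginc'.
rewrite inE => /orP[/eqP ->//|s'r].
have /cvg_ex[l Hl] := Hf _ s'r.
by apply/cvg_ex; exists l; apply: cvg_comp (increasing_seq_cvg ginc') Hl.
Qed.

End Subsequences.

(** * Limits of walk measures *)

Section LimitMeasures.
Variables (R : realType) (d N K : nat).
Hypotheses (hd : (0 < d)%N) (hN : (0 < N)%N) (hK : (0 < K)%N).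
Implicit Types (n : 'rV[int]_d) (xi : int -> 'rV[int]_d -> 'rV[R]_d).
Local Notation tau := (tstep R K).

Lemma walk_measure_exists xi n l : admissible N K xi -> odd_pt n -> (0 < l)%N ->
  exists mu : probability (borel_state R d) R, forall f : state R d -> R,
    measurable_fun [set: borel_state R d] (f : borel_state R d -> R) ->
    (\int[mu]_z (f z)%:E)%E =
    (\sum_(s : cell d N K) occupation hK xi n l s * f (cell_state xi s))%:E.
Proof.
move=> adm nodd l0.
apply: (@finite_probability_exists _ (borel_state R d) R (cell d N K)
  (@occupation R d N K hK xi n l) (@cell_state R d N K xi)).
  by move=> s; exact: occupation_ge0.
exact: occupation_sum1.
Qed.

(** The occupation probabilities live in a compact simplex, so that along a
    subsequence they converge, and with them the walk measures. *)
Lemma limit_measure_exists xi n : admissible N K xi -> odd_pt n ->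
  exists mu : probability (borel_state R d) R,
    exists mu_ : nat -> probability (borel_state R d) R,
       (forall l, (0 < l)%N -> is_walk_measure N K xi n l (mu_ l)) /\
       exists2 s : nat -> nat, {homo s : i j / (i < j)%N} &
         weak_cvg (fun i => mu_ (s i)) mu.
Proof.
move=> adm nodd; pose w l (s : cell d N K) := occupation hK xi n l s : R.
have w0 l s : 0 <= w l.+1 s by exact: occupation_ge0.
have w1 l : \sum_s w l.+1 s = 1 by exact: occupation_sum1.
have [mu_ Hmu_] := choice (fun l => walk_measure_exists adm nodd (ltn0Sn l)).
have [|f finc fcvg] := @bolzano_weierstrass_finite R _ (fun l => w l.+1).
  by move=> l s; rewrite ger0_norm//; exact: occupation_le1.
pose W s := limn (fun i => w (f i).+1 s).
have Wcvg s : w (f i).+1 s @[i --> \oo] --> W s by exact: fcvg.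
have W0 s : 0 <= W s.
  by apply: limr_ge; [exact: fcvg|exact: nearW].
have sum_cvg (a : cell d N K -> R) :
    \sum_s w (f i).+1 s * a s @[i --> \oo] --> \sum_s W s * a s.
  apply: cvg_big => [|s _]; first exact: add_continuous.
  by apply: cvgMl; exact: Wcvg.
have W1 : \sum_s W s = 1.
  have := sum_cvg (fun=> 1); under eq_bigr do rewrite mulr1.
  under eq_fun do under eq_bigr do rewrite mulr1.
  under eq_fun do rewrite w1.
  by move=> /cvg_lim <- //; rewrite lim_cst.
have [mu Hmu] := @finite_probability_exists _ (borel_state R d) R (cell d N K)
  W (@cell_state R d N K xi) W0 W1.
exists mu, (fun l => mu_ l.-1); split=> [[//|l] _|].
  by apply: walk_measureP => //; exact: Hmu_.
exists (fun i => (f i).+1) => [i j ij|g cg _]; first by rewrite ltnS finc.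
have mg := continuous_borel_measurable cg.
rewrite Hmu//; under eq_fun do rewrite /= Hmu_//.
apply: cvg_EFin; first exact: nearW.
exact: sum_cvg.
Qed.

End LimitMeasures.

Lemma continuous_pair_at (T U V : topologicalType) (f : T -> U) (g : T -> V) (z : T) :
  {for z, continuous f} -> {for z, continuous g} ->
  {for z, continuous (fun z => (f z, g z))}.
Proof. by move=> cf cg; exact: (cvg_pair cf cg). Qed.

(** * The action of a limit measure *)

Section ActionLimit.
Variables (R : realType) (d N K : nat).
Hypotheses (hd : (0 < d)%N) (hN : (0 < N)%N) (hK : (0 < K)%N).
Variable L : 'rV[R]_d * R * 'rV[R]_d -> R.
Hypothesis hL : lagrangian L.
Variable c : 'rV[R]_d.
Local Notation tau := (tstep R K).
Local Open Scope quotient_scope.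

Let A : R := (d%:R * mesh_ratio R N K)^-1.

Definition running_cost (z : state R d) : R :=
  lagrangian_c L c (repr z.1.1) (repr z.1.2 - tau) z.2.

Let shifted_cost (z : 'rV[R]_d * R * 'rV[R]_d) : R :=
  lagrangian_c L c z.1.1 (z.1.2 - tau) z.2.

Let shifted_cost_inv x x' t t' zeta : to_torus x = to_torus x' :> torus R d ->
  to_circle t = to_circle t' -> shifted_cost (x, t, zeta) = shifted_cost (x', t', zeta).
Proof.
move=> /to_torusP /mxOverP xx' /to_circleP tt'.
rewrite /shifted_cost /lagrangian_c/=; congr (_ - _).
rewrite -(subrK x' x) -(subrK t' t) [_ - _ + x']addrC [_ - _ + t']addrC addrAC.
rewrite -(floorK tt') lagrangian_time//.
rewrite (_ : x - x' = \row_j (Num.floor ((x - x') 0 j))%:~R) ?lagrangian_space//.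
by apply/rowP => j; rewrite [RHS]mxE floorK.
Qed.

Lemma running_cost_walk x t zeta :
  running_cost (to_torus x, to_circle t, zeta) = lagrangian_c L c x (t - tau) zeta.
Proof.
rewrite -[RHS]/(shifted_cost (x, t, zeta)) /running_cost.
rewrite -[LHS]/(shifted_cost (repr (to_torus x), repr (to_circle t), zeta)).
by apply: shifted_cost_inv; [exact: to_torus_repr|exact: to_circle_repr].
Qed.

Lemma running_cost_continuous : continuous running_cost.
Proof.
apply: (@state_fun_continuous R d shifted_cost); last exact: shifted_cost_inv.
have [_ [cL _ _] _ _ _] := hL.
move=> z; apply: (@continuousB _ _ _ (fun z => L (z.1.1, z.1.2 - tau, z.2)) (fun z => dot c z.2) z).
  apply: (@continuous_comp _ _ _
    (fun z : 'rV[R]_d * R * 'rV[R]_d => (z.1.1, z.1.2 - tau, z.2)) L); last exact: cL.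
  have c1 : {for z, continuous (fun z : 'rV[R]_d * R * 'rV[R]_d => z.1)} by exact: cvg_fst.
  have c11 : {for z.1, continuous (fun y : 'rV[R]_d * R => y.1)} by exact: cvg_fst.
  have c12 : {for z.1, continuous (fun y : 'rV[R]_d * R => y.2)} by exact: cvg_snd.
  apply: continuous_pair_at; last exact: cvg_snd.
  apply: continuous_pair_at; first exact: continuous_comp c1 c11.
  apply: (@continuousB _ _ _ (fun z : 'rV[R]_d * R * 'rV[R]_d => z.1.2) (cst tau) z).
    exact: continuous_comp c1 c12.
  exact: cvg_cst.
apply: (@continuous_comp _ _ _ (fun z : 'rV[R]_d * R * 'rV[R]_d => z.2) (dot c)).
  exact: cvg_snd.
exact: dot_continuous.
Qed.

(** Walk measures are only tested against compactly supported functions; the cost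
    becomes one when multiplied by this function, and is unchanged at the velocities
    of admissible controls. *)
Definition cutoff (z : state R d) : R := Num.max 0 (Num.min 1 (A + 1 - `|z.2|)).

Lemma cutoff_continuous : continuous cutoff.
Proof.
move=> z; apply: (@continuous_max _ _ (cst 0) (fun z => Num.min 1 (A + 1 - `|z.2|)) z).
  exact: cvg_cst.
apply: (@continuous_min _ _ (cst 1) (fun z : state R d => A + 1 - `|z.2|) z).
  exact: cvg_cst.
apply: (@continuousB _ _ _ (cst (A + 1)) (fun z : state R d => `|z.2|) z).
  exact: cvg_cst.
apply: (@continuous_comp _ _ _ (fun z : state R d => z.2) (fun v : 'rV[R]_d => `|v|)).
  exact: velocity_continuous.
exact: norm_continuous.
Qed.

Lemma cutoff_eq1 (z : state R d) : `|z.2| <= A -> cutoff z = 1.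
Proof.
move=> zA; rewrite /cutoff min_l; last by lra.
by rewrite max_r// ler01.
Qed.

Lemma cutoff_eq0 (z : state R d) : A + 1 < `|z.2| -> cutoff z = 0.
Proof. by move=> zA; rewrite /cutoff max_l// ge_min; apply/orP; right; lra. Qed.

Lemma cutoff_ge0 z : 0 <= cutoff z.
Proof. by rewrite /cutoff le_max lexx. Qed.

Lemma cutoff_le1 z : cutoff z <= 1.
Proof. by rewrite /cutoff ge_max ler01 ge_min lexx. Qed.

Variable xi : int -> 'rV[int]_d -> 'rV[R]_d.
Hypothesis adm : admissible N K xi.
Variable n : 'rV[int]_d.
Hypothesis nodd : odd_pt n.

Lemma integral_walk_cutoff l mu : (0 < l)%N -> is_walk_measure N K xi n l mu ->
  (\int[mu]_z (cutoff z)%:E)%E = 1%E.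
Proof.
move=> l0 H; rewrite H; first last.
- by apply: (@compactly_supported_velocity R d (A + 1)) => z; exact: cutoff_eq0.
- exact: cutoff_continuous.
congr EFin; rewrite -[RHS](sum_path_proba hd hN hK l adm nodd); apply: eq_bigr => p _.
have -> : time_average N K xi n cutoff p =
  index_average K (fun k m => cutoff (walk_state N K xi k m)) n p by [].
rewrite (@index_average_ext R d K _ (fun _ _ => 1))//; first by rewrite index_average_cst// mulr1.
by move=> k m mk; apply: cutoff_eq1; have [] := adm mk.
Qed.

Lemma integral_walk_cost l mu : (0 < l)%N -> is_walk_measure N K xi n l mu ->
  (\int[mu]_z (running_cost z * cutoff z)%:E)%E = (mean_action N K L c xi n l)%:E.
Proof.
move=> l0 H; rewrite H; first last.
- apply: (@compactly_supported_velocity R d (A + 1)) => z /cutoff_eq0 ->.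
  by rewrite mulr0.
- by move=> z; apply: cvgM; [exact: running_cost_continuous|exact: cutoff_continuous].
congr EFin; apply: eq_bigr => p _; congr (_ * _).
rewrite -[LHS]/(index_average K (fun k m => running_cost (walk_state N K xi k m) *
  cutoff (walk_state N K xi k m)) n p).
rewrite -[RHS]/(index_average K
  (fun k m => lagrangian_c L c (xpt R N m) (tpt R K k - tau) (xi k m)) n p).
apply: index_average_ext => // k m mk.
by rewrite cutoff_eq1 ?mulr1 ?running_cost_walk//; have [] := adm mk.
Qed.

Variables (mu_ : nat -> probability (borel_state R d) R) (s : nat -> nat)
  (mu : probability (borel_state R d) R).
Hypothesis Hmu_ : forall l, (0 < l)%N -> is_walk_measure N K xi n l (mu_ l).
Hypothesis sinc : {homo s : i j / (i < j)%N}.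
Hypothesis mucvg : weak_cvg (fun i => mu_ (s i)) mu.

Let s_gt0 : \forall i \near \oo, (0 < s i)%N.
Proof. by exists 1%N => // i /= i1; exact: leq_trans i1 (increasing_seq_ge _ sinc). Qed.

(** The integral of the cutoff is 1 for all walk measures, hence for their weak
    limit, and the cutoff is at most 1. *)
Lemma limit_cutoff_ae : {ae mu, forall z, cutoff z = 1}.
Proof.
have mchi := continuous_borel_measurable cutoff_continuous.
have chi1 : (\int[mu]_z (cutoff z)%:E)%E = 1%E.
  have cv : (\int[mu_ (s i)]_z (cutoff z)%:E)%E @[i --> \oo] --> (\int[mu]_z (cutoff z)%:E)%E.
    apply: mucvg; first exact: cutoff_continuous.
    by exists 1 => z; rewrite ger0_norm ?cutoff_ge0 ?cutoff_le1.
  apply: (cvg_unique _ cv) => //.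
  apply: cvg_near_cst; near=> i.
  have si : (0 < s i)%N by near: i; exact: s_gt0.
  exact: (integral_walk_cutoff si (Hmu_ si)).
have m1 : measurable_fun [set: borel_state R d] (fun z : borel_state R d => 1 - cutoff z).
  by apply: measurable_funB => //; exact: measurable_cst.
have int0 : (\int[mu]_z (1 - cutoff z)%:E)%E = 0%E.
  have : (\int[mu]_z ((cutoff z)%:E + (1 - cutoff z)%:E))%E = 1%E.
    under eq_integral do rewrite -EFinD addrC subrK.
    by rewrite integral_cst// mul1e; exact: probability_setT.
  rewrite ge0_integralD//; first last.
  - exact/measurable_EFinP.
  - by move=> z _; rewrite lee_fin subr_ge0 cutoff_le1.
  - exact/measurable_EFinP.
  - by move=> z _; rewrite lee_fin cutoff_ge0.
  rewrite chi1; case: (integral _ _ _) => //= x [].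
  by move=> /(congr1 (fun y => y - 1)); rewrite addrAC subrr add0r => ->.
have abs0 : (\int[mu]_z `|(1 - cutoff z)%:E|)%E = 0%E.
  rewrite -int0; apply: eq_integral => z _.
  by rewrite gee0_abs// lee_fin subr_ge0 cutoff_le1.
have mE1 : measurable_fun [set: borel_state R d]
    (fun z : borel_state R d => (1 - cutoff z)%:E) by exact/measurable_EFinP.
have := (ae_eq_integral_abs mu measurableT mE1).1 abs0.
apply: negligibleS => z /= z1; apply: contra_not z1 => /(_ Logic.I) [] /eqP.
by rewrite subr_eq0 => /eqP <-.
Unshelve. all: by end_near. Qed.

(** On the measures involved the cost agrees almost everywhere with its product with
    the cutoff, to which weak convergence applies. *)
Lemma mean_action_cvg :
  (mean_action N K L c xi n (s i))%:E @[i --> \oo] --> action K L c mu.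
Proof.
have cc : continuous (fun z : state R d => running_cost z * cutoff z).
  by move=> z; apply: cvgM; [exact: running_cost_continuous|exact: cutoff_continuous].
have -> : action K L c mu = (\int[mu]_z (running_cost z * cutoff z)%:E)%E.
  apply: ae_eq_integral => //.
  - apply/measurable_EFinP; exact: continuous_borel_measurable running_cost_continuous.
  - by apply/measurable_EFinP; exact: continuous_borel_measurable cc.
  - move: limit_cutoff_ae; apply: negligibleS => z /= zn; apply: contra_not zn => z1 _.
    by rewrite z1 mulr1.
have cv : (\int[mu_ (s i)]_z (running_cost z * cutoff z)%:E)%E @[i --> \oo] -->
    (\int[mu]_z (running_cost z * cutoff z)%:E)%E.
  apply: mucvg => //; apply: (@bounded_velocity R d (A + 1)) => // z /cutoff_eq0 ->.
  by rewrite mulr0.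
apply: cvg_trans cv; apply: near_eq_cvg; near=> i.
have si : (0 < s i)%N by near: i; exact: s_gt0.
by rewrite (integral_walk_cost si (Hmu_ si)).
Unshelve. all: by end_near. Qed.

Lemma mean_error_small (M e : R) : 0 < e ->
  \forall i \near \oo, (0 < s i)%N /\ M / tpt R K (s i) <= e.
Proof.
move=> e0; near=> i.
have si : (0 < s i)%N by near: i; exact: s_gt0.
split=> //; have t0 := tpt_gt0 R hK si.
rewrite ler_pdivrMr// /tpt mulrA -ler_pdivrMl ?mulr_gt0 ?tstep_gt0//.
apply: (@le_trans _ _ i%:R); last by rewrite -pmulrn ler_nat; exact: increasing_seq_ge.
by near: i; exact: nbhs_infty_ger.
Unshelve. all: by end_near. Qed.

Lemma action_ge (Hc M : R) :
  (forall l, (0 < l)%N -> - Hc - M / tpt R K l <= mean_action N K L c xi n l) ->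
  ((- Hc)%:E <= action K L c mu)%E.
Proof.
move=> H; apply/lee_addgt0Pr => e e0.
rewrite -leeBlDr// -EFinB; apply: cvge_to_ge mean_action_cvg _; near=> i.
have [si Mi] : (0 < s i)%N /\ M / tpt R K (s i) <= e by near: i; exact: mean_error_small.
by rewrite lee_fin; have := H _ si; lra.
Unshelve. all: by end_near. Qed.

Lemma action_le (Hc M : R) :
  (forall l, (0 < l)%N -> mean_action N K L c xi n l <= - Hc + M / tpt R K l) ->
  (action K L c mu <= (- Hc)%:E)%E.
Proof.
move=> H; apply/lee_addgt0Pr => e e0.
rewrite -EFinD; apply: cvge_to_le mean_action_cvg _; near=> i.
have [si Mi] : (0 < s i)%N /\ M / tpt R K (s i) <= e by near: i; exact: mean_error_small.
by rewrite lee_fin; have := H _ si; lra.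
Unshelve. all: by end_near. Qed.

End ActionLimit.

Theorem theorem3p5 (R : realType) (d : nat) (hd : (0 < d)%N)
  (L : 'rV[R]_d * R * 'rV[R]_d -> R) (hL : lagrangian L)
  (P : set 'rV[R]_d) (hPc : compact P)
  (hPconv : convex_set (P : set (convex_lmodType 'rV[R]_d)))
  (r : R) (hr : 0 < r)
  (N K : nat) (hN : (0 < N)%N) (hK : (0 < K)%N)
  (lambda1 : R) (hlambda1 : 0 < lambda1)
  (hlambda : mesh_ratio R N K < lambda1)
  (hstable : forall c, P c -> forall v0, Xdelta N r v0 ->
     Xdelta N r (phi N K L c v0 (2 * K)))
  (hCFL : forall c, P c -> forall v0, Xdelta N r v0 ->
     forall (k : nat) (m : 'rV[int]_d), on_G m k ->
       `|hamiltonian_p L (xpt R N m) (tpt R K k)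
           (c + Dx N (phi N K L c v0 k) m)| <= (d%:R * lambda1)^-1)
  (n0 : 'rV[int]_d) (hn0 : odd_pt n0)
  (c : 'rV[R]_d) (hc : P c) :
  ereal_inf [set action K L c mu | mu in Pdelta N K n0]
    = (- Hbar N K L r c)%:E /\
  exists2 mu_star, Pdelta N K n0 mu_star &
    action K L c mu_star = ereal_inf [set action K L c mu | mu in Pdelta N K n0].
Proof.
have ex := effective_hamiltonian_exists hd hN hK hL hr hlambda1 hlambda (hstable c hc)
  (hCFL c hc) hn0.
have [vbar Xvbar vbarE] : is_effective_hamiltonian N K L r c (Hbar N K L r c).
  exact: xgetPex ex.
set Hc := Hbar N K L r c in vbarE *.
have lower mu : Pdelta N K n0 mu -> ((- Hc)%:E <= action K L c mu)%E.
  move=> [xi [adm [mu_ [Hmu_ [s sinc mucvg]]]]].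
  have [M HM] := mean_action_ge hd hN hK hL Xvbar vbarE hn0.
  by apply: (action_ge hd hN hK hL adm hn0 Hmu_ sinc mucvg (M := M)) => l; exact: HM.
pose xi := optimal_control N K L c vbar.
have adm : admissible N K xi.
  exact: (optimal_control_admissible hd hN hK hL Xvbar (ltW hlambda) (hCFL c hc _ Xvbar)).
have [mu [mu_ [Hmu_ [s sinc mucvg]]]] := limit_measure_exists hd hN hK adm hn0.
have Pmu : Pdelta N K n0 mu by exists xi; split=> //; exists mu_; split=> //; exists s.
have actionE : action K L c mu = (- Hc)%:E.
  apply/eqP; rewrite eq_le lower// andbT.
  have [M HM] := mean_action_optimal_le hd hN hK hL Xvbar vbarE hn0 adm.
  by apply: (action_le hd hN hK hL adm hn0 Hmu_ sinc mucvg (M := M)) => l; exact: HM.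
have infE : ereal_inf [set action K L c mu | mu in Pdelta N K n0] = (- Hc)%:E.
  apply/eqP; rewrite eq_le; apply/andP; split.
    by rewrite -actionE; apply: ereal_inf_lbound; exists mu.
  by apply: le_ereal_inf_tmp => _ [mu' Pmu' <-]; exact: lower.
by split=> //; exists mu => //; rewrite infE.
Qed.
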